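(* Let $p_i(t)=a_{d,i}t^d+\dots+a_{1,i}t+a_{0,i}$ with $a_{k,i}\ge0$ for $k=0,\dots,d$ and $i=1,\dots,d+1$, and let $\alpha_i,\beta_i\in\mathbb R$, $\alpha_i\ge0$, $\beta_i>0$ for $i=1,\dots,d+1$. Set $$k_i(x,y)=p_i\left(\left(\sqrt{\beta_i}x-\frac{\alpha_i}{\sqrt{\beta_i}}\right)\left(\sqrt{\beta_i}y-\frac{\alpha_i}{\sqrt{\beta_i}}\right)\right)e^{\beta_ixy-\alpha_i(x+y)}$$ and define $k(x,y)=\sum_{i=1}^{d+1}k_i(x,y)$. Then $k$ is a fully consistent kernel and gives rise to the RKHS given by the direct sum $$\mathcal H(k)=\mathcal H(k_1)\oplus\dots\oplus\mathcal H(k_{d+1}),$$ with norm $$\|f\|_{\mathcal H(k)}^2=\min\left\{\sum_{i=1}^{d+1}\|f_i\|_{\mathcal H(k_i)}^2:\ f=\sum_{i=1}^{d+1}f_i,\ f_i\in\mathcal H(k_i),\ i=1,\dots,d+1\right\},$$ where the spaces $\mathcal H(k_1),\dots,\mathcal H(k_{d+1})$ are the RKHSs of the kernels $k_i$ described in the context.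
   Context: A kernel function on $\mathbb R_+$ is a symmetric function $k:\mathbb R_+\times\mathbb R_+\to\mathbb R$ such that for all $n$ and distinct $x_1,\dots,x_n\in\mathbb R_+$ the matrix $(k(x_i,x_j))_{i,j}$ is positive semidefinite; it is the reproducing kernel of a unique reproducing kernel Hilbert space (RKHS: a Hilbert space of functions with bounded point evaluations), denoted $\mathcal H(k)$. Writing $k_y:x\mapsto k(y,x)$, a kernel function is called fully consistent if for any $N\in\mathbb N$ and any $y_1,\dots,y_N\in\mathbb R_+$ there is a finite-dimensional space $V\subseteq C^1(\mathbb R_+,\mathbb R)$ with $\partial_x(V)\subseteq V$ and $k_{y_1},\dots,k_{y_N}\in V$. The spaces $\mathcal H(k_i)$: for each $i$ and $m\in\mathbb N_0$ let $h_{m,i}:=e^{-\alpha_i^2/\beta_i}\sum_{l=0}^{\min(m,\deg p_i)}\binom{m}{l}l!\,a_{l,i}$, let $w_{m,i}:=h_{m,i}^{-1}$ if $h_{m,i}>0$ and $w_{m,i}:=0$ otherwise, and $w_i=(w_{m,i})_{m\ge0}$. Then $\mathcal H(k_i)$ is the set of $f:\mathbb R_+\to\mathbb R$ with $f(x)=\sum_{m\ge0}\mathbf 1_{\{h_{m,i}>0\}}b_m(x-\alpha_i/\beta_i)^m$ and $\|(b_m)_{m\ge0}\|_{\ell^2_{w_i}}<\infty$, where $b_m=f^{(m)}(\alpha_i/\beta_i)/m!$ and $\|b\|_{\ell^2_{w}}^2=\sum_m w_m|b_m|^2$ is the weighted $\ell^2$ norm, equipped with the norm $\|f\|^2_{\mathcal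 H(k_i)}=\sum_{m\ge0}\frac{w_{m,i}}{\beta_i^m m!}|f^{(m)}(\alpha_i/\beta_i)|^2$ and the inner product $\langle f,g\rangle_{\mathcal H(k_i)}=\sum_{m\ge0}\frac{w_{m,i}}{\beta_i^m m!}f^{(m)}(\alpha_i/\beta_i)g^{(m)}(\alpha_i/\beta_i)$.
   Formalization: In the description of H(k_i), finiteness of the norm ‖f‖_{H(k_i)} is required in addition to ‖(b_m)‖_{ℓ²_w}<∞, since the latter alone admits functions of infinite norm (for k=e^{xy}, f=e^{x²}). *)

(* Defs.v *)
From mathcomp Require Import all_boot all_order all_algebra.
From mathcomp Require Import all_classical all_reals all_analysis.

Set Implicit Arguments.
Unset Strict Implicit.
Unset Printing Implicit Defensive.

Import Order.TTheory GRing.Theory Num.Theory.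
Import numFieldNormedType.Exports.

Local Open Scope classical_set_scope.
Local Open Scope ring_scope.

(* Used as a type, through the coercion [set_type]; it then carries the subspace
   topology of [R], and [\val] is the inclusion into [R]. *)
Definition Rp (R : realType) : set R := [set x : R | 0 <= x].
Arguments Rp R : clear implicits.

Definition Rp0 (R : realType) : Rp R :=
  @SigSub _ _ (Rp R) 0 (mem_set (lexx 0)).
Arguments Rp0 R : clear implicits.

(* Only used at nonnegative [x]; a negative [x] is sent to 0. *)
Definition toRp (R : realType) (x : R) : Rp R := insubd (Rp0 R) x.

Section kernels.
Context {R : realType} {T : Type}.
Implicit Types (k : T -> T -> R) (f g : T -> R).

Definition psd n (M : 'M[R]_n) : Prop :=
  M^T = M /\ forall v : 'cV[R]_n, 0 <= (v^T *m M *m v) 0 0.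

Definition is_kernel k : Prop :=
  (forall x y, k x y = k y x) /\
  forall n (x : 'I_n -> T), injective x -> psd (\matrix_(i, j) k (x i) (x j)).

(* A candidate Hilbert space of functions: its elements and its inner product;
   the values of the inner product outside the elements are irrelevant. *)
Record fun_space := FunSpace {
  fs_set :> (T -> R) -> Prop;
  fs_dot : (T -> R) -> (T -> R) -> R }.

Definition fs_norm (H : fun_space) f : R := Num.sqrt (fs_dot H f f).

Record is_hilbert (H : fun_space) : Prop := IsHilbert {
  hilbert0 : H 0;
  hilbertP : forall (a : R) f g, H f -> H g -> H (a *: f + g);
  dot_sym : forall f g, H f -> H g -> fs_dot H f g = fs_dot H g f;
  dot_linear : forall (a : R) f g h, H f -> H g -> H h ->
    fs_dot H (a *: f + g) h = a * fs_dot H f h + fs_dot H g h;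
  dot_ge0 : forall f, H f -> 0 <= fs_dot H f f;
  dot_eq0 : forall f, H f -> fs_dot H f f = 0 -> f = 0;
  hilbert_complete : forall u : nat -> T -> R, (forall n, H (u n)) ->
    (forall e : R, 0 < e ->
       \forall m & n \near \oo, fs_norm H (u m - u n) < e) ->
    exists2 f, H f & fs_norm H (u n - f) @[n --> \oo] --> (0 : R) }.

Definition is_rkhs (H : fun_space) : Prop :=
  is_hilbert H /\
  forall x : T, exists C : R, forall f, H f -> `|f x| <= C * fs_norm H f.

Definition is_rkhs_of k (H : fun_space) : Prop :=
  [/\ is_rkhs H, forall x, H (k x) &
      forall f, H f -> forall x, f x = fs_dot H f (k x)].

Definition fin_dim_subspace (V : set (T -> R)) : Prop :=
  exists n (e : 'I_n -> T -> R),
    V = [set f | exists c : 'I_n -> R, f = \sum_(i < n) c i *: e i].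

End kernels.

Definition is_min {R : realType} (A : set R) (m : R) : Prop :=
  A m /\ lbound A m.

Section halfline.
Context {R : realType}.
Implicit Types (f : Rp R -> R) (x : Rp R).

Definition dquot f x (y : Rp R) : R := (f y - f x) / (\val y - \val x).

(* As [y] ranges over [Rp R], derivatives are one-sided at 0. *)
Definition derivable_Rp f x : Prop := cvg (dquot f x y @[y --> x^']).

Definition deriv_Rp f : Rp R -> R := fun x => lim (dquot f x y @[y --> x^']).

Definition C1_Rp : set (Rp R -> R) :=
  [set f | (forall x, derivable_Rp f x) /\ continuous (deriv_Rp f)].

Definition fully_consistent (k : Rp R -> Rp R -> R) : Prop :=
  forall N (y : 'I_N -> Rp R), exists V : set (Rp R -> R),
    [/\ fin_dim_subspace V, V `<=` C1_Rp,
        forall f, V f -> V (deriv_Rp f) & forall j, V (k (y j))].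

End halfline.

Section spaces.
Context {R : realType}.
Implicit Types (p : {poly R}) (alpha beta : R) (f : Rp R -> R).

Definition ki p alpha beta (x y : Rp R) : R :=
  p.[(Num.sqrt beta * \val x - alpha / Num.sqrt beta) *
     (Num.sqrt beta * \val y - alpha / Num.sqrt beta)] *
  expR (beta * \val x * \val y - alpha * (\val x + \val y)).

Definition hcoef p alpha beta (m : nat) : R :=
  expR (- (alpha ^+ 2 / beta)) *
  \sum_(0 <= l < (minn m (size p).-1).+1) 'C(m, l)%:R * l`!%:R * p`_l.

Definition wcoef p alpha beta (m : nat) : R :=
  if 0 < hcoef p alpha beta m then (hcoef p alpha beta m)^-1 else 0.

Definition wl2_normsq (w b : nat -> R) : \bar R :=
  (\sum_(0 <= m <oo) (w m * `|b m| ^+ 2)%:E)%E.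

Definition dcenter alpha beta f (m : nat) : R :=
  iter m deriv_Rp f (toRp (alpha / beta)).

Definition Hweight p alpha beta (m : nat) : R :=
  wcoef p alpha beta m / (beta ^+ m * m`!%:R).

(* The expansion in the first clause converges on the whole half-line, so it
   already forces [f] to be smooth and the numbers [dcenter alpha beta f m] to
   be genuine derivatives.  The last clause says that the norm is finite; it is
   not implied by the [wl2_normsq] condition on [b]: for [p = 1], [alpha = 0],
   [beta = 1] (so [ki] is [expR (x * y)]), [x |-> expR (x ^+ 2)] satisfies the
   first two clauses but has infinite norm. *)
Definition Hki_set p alpha beta : set (Rp R -> R) :=
  [set f | let b := fun m => dcenter alpha beta f m / m`!%:R in
    [/\ forall x : Rp R,
          series (fun m => (0 < hcoef p alpha beta m)%R%:R * b m *
                           (\val x - alpha / beta) ^+ m) @ \oo --> f x,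
        (wl2_normsq (wcoef p alpha beta) b < +oo)%E &
        (wl2_normsq (Hweight p alpha beta) (dcenter alpha beta f) < +oo)%E]].

Definition Hki_dot p alpha beta f g : R :=
  limn (series (fun m => Hweight p alpha beta m *
                         dcenter alpha beta f m * dcenter alpha beta g m)).

Definition Hki p alpha beta : fun_space :=
  FunSpace (Hki_set p alpha beta) (Hki_dot p alpha beta).

End spaces.

(* The sum of the spaces [H i] inside the space of all functions; the summands
   may intersect nontrivially, so decompositions need not be unique. *)
Definition sum_set {R : realType} {T : Type} {n : nat}
    (H : 'I_n -> @fun_space R T) : set (T -> R) :=
  [set f | exists2 g : 'I_n -> T -> R,
             forall i, H i (g i) & f = \sum_(i < n) g i].

Definition sum_normsq_set {R : realType} {T : Type} {n : nat}
    (H : 'I_n -> @fun_space R T) (f : T -> R) : set R :=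
  [set s | exists g : 'I_n -> T -> R,
     [/\ forall i, H i (g i), f = \sum_(i < n) g i &
         s = \sum_(i < n) fs_norm (H i) (g i) ^+ 2]].

(* Main.v *)
(* Put [u = x - alpha / beta] and [v = y - alpha / beta].  Then [ki x y] is
   [expR (- alpha^2 / beta) * p(beta u v) * expR (beta u v)], and expanding
   [t^l e^t] gives [ki x y = \sum_m hcoef m * beta^m / m! * (u v)^m].  Hence
   [Hki] is a weighted l2 space of entire Taylor series at [alpha / beta], whose
   coefficients are recovered by (possibly one-sided) differentiation.
   For the sum of kernels (Aronszajn), the direct sum of the [Hki] is a Hilbert
   space [D] of functions on ['I_n * T]; each [f] in the sum space has a unique
   preimage in [D] orthogonal to the kernel of the summation map, obtained by
   projection, and this preimage has minimal norm.  Transporting the structure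
   of [D] along it gives a Hilbert space with reproducing kernel [k], and a
   reproducing kernel determines its space.  Full consistency holds because
   [k y] is a combination of functions [x^m expR (g x)] with [m <= d]. *)

Require Import Defs.
From mathcomp Require Import all_boot all_order all_algebra.
From mathcomp Require Import all_classical all_reals all_analysis.
From mathcomp Require Import ring lra.

Set Implicit Arguments.
Unset Strict Implicit.
Unset Printing Implicit Defensive.

Import Order.TTheory GRing.Theory Num.Theory.
Import numFieldNormedType.Exports.

Local Open Scope classical_set_scope.
Local Open Scope ring_scope.

(** * Hilbert spaces of functions and projections *)

Definition subspace_of {R : realType} {T : Type} (H : @fun_space R T)
    (W : set (T -> R)) : Prop :=
  [/\ W `<=` fs_set H, W 0 & forall (a : R) f g, W f -> W g -> W (a *: f + g)].

Lemma cvg_of_dist_le {R : realType} (w v : nat -> R) (l : R) :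
  (forall n, `|v n - l| <= w n) -> w n @[n --> \oo] --> (0 : R) ->
  v n @[n --> \oo] --> l.
Proof.
move=> vw w0; apply/cvgrPdist_lt => e e0.
move/cvgrPdist_lt : w0 => /(_ _ e0); apply: filterS => n.
rewrite sub0r normrN distrC => wn; apply: le_lt_trans (vw n) _.
by apply: le_lt_trans wn; exact: ler_norm.
Qed.

Section hilbert_theory.
Context {R : realType} {T : Type} (H : @fun_space R T) (hH : is_hilbert H).
Implicit Types (f g h : T -> R) (a : R).
Local Notation dot := (fs_dot H).
Local Notation nrm := (fs_norm H).

Lemma hilbertD f g : H f -> H g -> H (f + g).
Proof. by move=> Hf Hg; rewrite -[f]scale1r; exact: hilbertP. Qed.

Lemma hilbertZ a f : H f -> H (a *: f).
Proof. by move=> Hf; rewrite -[_ *: _]addr0; apply: hilbertP => //; exact: hilbert0. Qed.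

Lemma hilbertB f g : H f -> H g -> H (f - g).
Proof. by move=> Hf Hg; apply: hilbertD => //; rewrite -scaleN1r; exact: hilbertZ. Qed.

#[local] Hint Extern 0 (fs_set _ (_ - _)) => solve [exact: hilbertB] : core.
#[local] Hint Extern 0 (fs_set _ (_ + _)) => solve [exact: hilbertD] : core.
#[local] Hint Extern 0 (fs_set _ (_ *: _)) => solve [exact: hilbertZ] : core.

Lemma hilbert_sum (I : Type) (s : seq I) (P : pred I) (F : I -> T -> R) :
  (forall i, P i -> H (F i)) -> H (\sum_(i <- s | P i) F i).
Proof. by move=> HF; elim/big_rec: _ => [|i f Pi]; [exact: hilbert0|exact/hilbertD/HF]. Qed.

Lemma dotDl f g h : H f -> H g -> H h -> dot (f + g) h = dot f h + dot g h.
Proof. by move=> Hf Hg Hh; rewrite -[f]scale1r dot_linear// scale1r mul1r. Qed.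

Lemma dot0l h : H h -> dot 0 h = 0.
Proof.
move=> Hh; have /(congr1 (fun x => x - dot 0 h)) := dotDl (hilbert0 hH) (hilbert0 hH) Hh.
by rewrite addr0 subrr addrK.
Qed.

Lemma dotZl a f h : H f -> H h -> dot (a *: f) h = a * dot f h.
Proof.
move=> Hf Hh; rewrite -[a *: f]addr0 dot_linear//; last exact: hilbert0.
by rewrite dot0l// addr0.
Qed.

Lemma dotBl f g h : H f -> H g -> H h -> dot (f - g) h = dot f h - dot g h.
Proof.
move=> Hf Hg Hh; rewrite dotDl//; last by rewrite -scaleN1r; exact: hilbertZ.
by rewrite -scaleN1r dotZl// mulN1r.
Qed.

Lemma dot_suml (I : Type) (s : seq I) (P : pred I) (F : I -> T -> R) h :
  (forall i, P i -> H (F i)) -> H h ->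
  dot (\sum_(i <- s | P i) F i) h = \sum_(i <- s | P i) dot (F i) h.
Proof.
move=> HF Hh; elim: s => [|i s IH]; first by rewrite !big_nil dot0l.
rewrite !big_cons; case: ifP => // Pi; rewrite dotDl ?IH//; first exact: HF.
exact: hilbert_sum.
Qed.

Lemma dot_sumr (I : Type) (s : seq I) (P : pred I) (F : I -> T -> R) h :
  (forall i, P i -> H (F i)) -> H h ->
  dot h (\sum_(i <- s | P i) F i) = \sum_(i <- s | P i) dot h (F i).
Proof.
move=> HF Hh; rewrite dot_sym//; last exact: hilbert_sum.
by rewrite dot_suml//; apply: eq_bigr => i Pi; apply: dot_sym => //; exact: HF.
Qed.

Lemma dotZr a f h : H f -> H h -> dot h (a *: f) = a * dot h f.
Proof. by move=> Hf Hh; rewrite dot_sym ?dotZl 1?(dot_sym hH Hf)//; exact: hilbertZ. Qed.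

Lemma dotDZ a f g : H f -> H g ->
  dot (f + a *: g) (f + a *: g) = dot f f + 2 * a * dot f g + a ^+ 2 * dot g g.
Proof.
move=> Hf Hg; have Ha := hilbertZ a Hg; have Hs := hilbertD Hf Ha.
rewrite dotDl// dotZl// (dot_sym hH Hf)// (dot_sym hH Hg)// !dotDl// !dotZl//.
rewrite (dot_sym hH Hg)//; ring.
Qed.

Lemma fs_norm_ge0 f : 0 <= nrm f. Proof. exact: sqrtr_ge0. Qed.

Lemma fs_normsq f : H f -> nrm f ^+ 2 = dot f f.
Proof. by move=> Hf; rewrite sqr_sqrtr// dot_ge0. Qed.

(** Removing from [f] its component along [g] leaves a vector of nonnegative squared norm; when
    [dot g g = 0], definiteness forces [g = 0]. *)
Lemma dot_CSsq f g : H f -> H g -> dot f g ^+ 2 <= dot f f * dot g g.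
Proof.
move=> Hf Hg; have [g0|g0] := eqVneq (dot g g) 0.
  by rewrite (dot_eq0 hH Hg g0) dot_sym ?dot0l ?expr0n ?mulr0//; exact: hilbert0.
have gp : 0 < dot g g by rewrite lt_neqAle eq_sym g0 dot_ge0.
have := dot_ge0 hH (hilbertD Hf (hilbertZ (- (dot f g / dot g g)) Hg)).
rewrite dotDZ//.
have -> : dot f f + 2 * - (dot f g / dot g g) * dot f g +
   (- (dot f g / dot g g)) ^+ 2 * dot g g = dot f f - dot f g ^+ 2 / dot g g by field.
by rewrite subr_ge0 ler_pdivrMr.
Qed.

Lemma dot_CS f g : H f -> H g -> `|dot f g| <= nrm f * nrm g.
Proof.
move=> Hf Hg; rewrite -(@ler_pXn2r _ 2) ?nnegrE ?mulr_ge0 ?fs_norm_ge0//.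
by rewrite exprMn !fs_normsq// real_normK ?num_real// dot_CSsq.
Qed.

Lemma fs_normD f g : H f -> H g -> nrm (f + g) <= nrm f + nrm g.
Proof.
move=> Hf Hg; rewrite -(@ler_pXn2r _ 2) ?nnegrE ?addr_ge0 ?fs_norm_ge0//.
rewrite fs_normsq//; have := dotDZ 1 Hf Hg; rewrite scale1r => ->.
rewrite sqrrD !fs_normsq//.
have := ler_norm (dot f g); have := dot_CS Hf Hg; lra.
Qed.

Lemma fs_normZ a f : H f -> nrm (a *: f) = `|a| * nrm f.
Proof.
move=> Hf; apply/eqP; rewrite -(@eqrXn2 _ 2) ?mulr_ge0 ?fs_norm_ge0//.
rewrite exprMn !fs_normsq// dotZl// dotZr//.
by rewrite mulrA real_normK ?num_real.
Qed.

Lemma fs_normB f g : H f -> H g -> nrm (f - g) = nrm (g - f).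
Proof.
by move=> Hf Hg; rewrite -[f - g]opprB -scaleN1r fs_normZ// normrN1 mul1r.
Qed.

Lemma fs_norm_dist f g : H f -> H g -> `|nrm f - nrm g| <= nrm (f - g).
Proof.
move=> Hf Hg; have := fs_normD (hilbertB Hf Hg) Hg; have := fs_normD (hilbertB Hg Hf) Hf.
by rewrite !subrK (fs_normB Hg Hf) ler_norml; lra.
Qed.

Definition fs_cvg (u : nat -> T -> R) f := nrm (u n - f) @[n --> \oo] --> (0 : R).

Lemma fs_cvg_dot u f g : (forall n, H (u n)) -> H f -> H g -> fs_cvg u f ->
  dot (u n) g @[n --> \oo] --> dot f g.
Proof.
move=> Hu Hf Hg uf; apply: (@cvg_of_dist_le _ (fun n => nrm (u n - f) * nrm g)).
  by move=> n; rewrite -dotBl//; apply: dot_CS => //; exact: hilbertB.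
by rewrite -(mul0r (nrm g)); apply: cvgM => //; exact: cvg_cst.
Qed.

Lemma fs_cvg_norm u f : (forall n, H (u n)) -> H f -> fs_cvg u f ->
  nrm (u n) @[n --> \oo] --> nrm f.
Proof.
move=> Hu Hf uf.
by apply: (@cvg_of_dist_le _ (fun n => nrm (u n - f))) => // n; exact: fs_norm_dist.
Qed.

Lemma fs_cvg_cauchy u f : (forall n, H (u n)) -> H f -> fs_cvg u f ->
  forall e : R, 0 < e -> \forall m & n \near \oo, nrm (u m - u n) < e.
Proof.
move=> Hu Hf /cvgrPdist_lt uf e e0.
have e20 : 0 < e / 2 by rewrite divr_gt0.
have {}uf : \forall n \near \oo, nrm (u n - f) < e / 2.
  have := uf _ e20; apply: filterS => n.
  by rewrite sub0r normrN ger0_norm ?fs_norm_ge0.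
exists ([set n | nrm (u n - f) < e / 2], [set n | nrm (u n - f) < e / 2]) => //=.
move=> [m n] /= [um un].
rewrite (_ : u m - u n = (u m - f) + (f - u n)); last by rewrite addrA subrK.
rewrite (le_lt_trans (fs_normD _ _))// (fs_normB Hf)//; lra.
Qed.

(* [g] is the projection of [f] onto the closure of [W], which need not be closed;
   a minimizing sequence [u] is Cauchy by the parallelogram law. *)
Lemma hilbert_proj (W : set (T -> R)) f : subspace_of H W -> H f ->
  exists u g, [/\ forall n : nat, W (u n), H g, fs_cvg u g &
                 forall w, W w -> dot (f - g) w = 0].
Proof.
move=> [WH W0 WP] Hf.
pose q w := dot (f - w) (f - w).
pose D := [set q w | w in W].
have hD : has_inf D.
  split; first by exists (q 0), 0.
  by exists 0 => _ [w Ww <-]; apply: (dot_ge0 hH); apply: hilbertB => //; exact: WH.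
pose delta := inf D.
have qdelta w : W w -> delta <= q w.
  by move=> Ww; apply: ge_inf; [case: hD|exists w].
have /choice[u uP] : forall n : nat, exists w, W w /\ q w < delta + n.+1%:R^-1.
  move=> n; have n0 : 0 < n.+1%:R^-1 :> R by rewrite invr_gt0.
  by have [_ [w Ww <-] qw] := inf_adherent n0 hD; exists w.
have Wu n : W (u n) by case: (uP n).
have Hu n : H (u n) by exact: WH.
have qu n : q (u n) < delta + n.+1%:R^-1 by case: (uP n).
(* Parallelogram identity for [f - u m] and [f - u n]: the midpoint of [u m] and [u n] lies in [W],
   so its squared distance to [f] is at least [delta]. *)
have par m n : nrm (u m - u n) ^+ 2 <= 2 * (m.+1%:R^-1 + n.+1%:R^-1).
  have Hm := hilbertB Hf (Hu m); have Hn := hilbertB Hf (Hu n).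
  have Wmid : W (2^-1 *: (u m + u n)).
    have -> : 2^-1 *: (u m + u n) = 2^-1 *: u m + (2^-1 *: u n + 0).
      by rewrite addr0 scalerDr.
    by apply: (WP) => //; exact: WP.
  have := qdelta _ Wmid.
  rewrite fs_normsq; last exact: hilbertB.
  have -> : u m - u n = (f - u n) + (-1) *: (f - u m).
    by rewrite scaleN1r; apply/funext => x; rewrite !fctE; ring.
  have qm : q (2^-1 *: (u m + u n)) = 4^-1 * dot ((f - u n) + 1 *: (f - u m))
      ((f - u n) + 1 *: (f - u m)).
    rewrite /q (_ : f - 2^-1 *: (u m + u n) = 2^-1 *: ((f - u n) + 1 *: (f - u m))).
      have Hs : H ((f - u n) + 1 *: (f - u m)) by rewrite scale1r; exact: hilbertD.
      by rewrite dotZl// dotZr// mulrA; congr (_ * _); field.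
    by apply/funext => x; rewrite !fctE /= /GRing.scale /=; field.
  rewrite qm !dotDZ//.
  have := qu m; have := qu n; rewrite /q.
  set A := dot (f - u n) _; set B := dot _ (f - u m); set C := dot _ (f - u m).
  by rewrite sqrrN expr1n; move: (m.+1%:R^-1) (n.+1%:R^-1) A B C => r s A B C; lra.
have [g Hg ug] : exists2 g, H g & fs_cvg u g.
  apply: (hilbert_complete hH Hu) => e e0.
  (* By [par], two reciprocals below [e ^+ 2 / 4] give a squared distance below [e ^+ 2]. *)
  have e4 : 0 < e ^+ 2 / 4 by rewrite divr_gt0// exprn_gt0.
  have N : \forall n \near \oo, (n.+1%:R^-1 : R) < e ^+ 2 / 4.
    exact: near_infty_natSinv_lt (PosNum e4).
  exists ([set n : nat | (n.+1%:R^-1 : R) < e ^+ 2 / 4],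
          [set n : nat | (n.+1%:R^-1 : R) < e ^+ 2 / 4]) => //=.
  move=> [m n] /= [hm hn].
  rewrite -(@ltr_pXn2r _ 2) ?nnegrE ?fs_norm_ge0// ?ltW//.
  apply: le_lt_trans (par m n) _; move: hm hn.
  by move: (m.+1%:R^-1) (n.+1%:R^-1) (e ^+ 2) => r s A; lra.
exists u, g; split=> // w Ww.
have Hw := WH _ Ww; have Hfg := hilbertB Hf Hg.
(* [g] need not lie in [W], so the bound is taken at [f - (u n - t *: w)] and passed to the
   limit. *)
have key t : delta <= dot (f - g + t *: w) (f - g + t *: w).
  rewrite -fs_normsq; last by apply: hilbertD => //; exact: hilbertZ.
  have Hv n : H (f - u n + t *: w) by apply/hilbertD/hilbertZ => //; exact: hilbertB.
  have Hv' : H (f - g + t *: w) by apply/hilbertD/hilbertZ.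
  have vc : fs_cvg (fun n => f - u n + t *: w) (f - g + t *: w).
    rewrite /fs_cvg (_ : (fun n => _) = (fun n => nrm (u n - g)))//.
    apply/funext => n; rewrite fs_normB//; congr nrm.
    by apply/funext => x; rewrite !fctE /=; ring.
  have vn := fs_cvg_norm Hv Hv' vc.
  have vn2 : nrm (f - u n + t *: w) ^+ 2 @[n --> \oo] --> nrm (f - g + t *: w) ^+ 2.
    exact: cvgM.
  apply: (cvgr_to_ge vn2); near=> n; rewrite fs_normsq//.
  rewrite (_ : f - u n + t *: w = f - (- t *: w + u n)).
    by apply: qdelta; exact: WP.
  by rewrite scaleNr opprD opprK addrA addrAC.
have qg : dot (f - g) (f - g) <= delta.
  rewrite -fs_normsq//.
  have Hv n := hilbertB Hf (Hu n).
  have vc : fs_cvg (fun n => f - u n) (f - g).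
    rewrite /fs_cvg (_ : (fun n => _) = (fun n => nrm (u n - g)))//.
    apply/funext => n; rewrite fs_normB//; congr nrm.
    by apply/funext => x; rewrite !fctE /=; ring.
  have vn := fs_cvg_norm Hv Hfg vc.
  have vn2 : nrm (f - u n) ^+ 2 @[n --> \oo] --> nrm (f - g) ^+ 2 by exact: cvgM.
  apply/ler_addgt0Pr => e e0.
  apply: (cvgr_to_le vn2).
  have : \forall n \near \oo, (n.+1%:R^-1 : R) < e by exact: near_infty_natSinv_lt (PosNum e0).
  apply: filterS => n hn; rewrite fs_normsq//; apply/ltW/(lt_trans (qu n)).
  by rewrite ltrD2l.
have [w0|w0] := eqVneq (dot w w) 0.
  by rewrite (dot_eq0 hH Hw w0) dot_sym ?dot0l//; exact: hilbert0.
(* This multiple of [w] minimizes the quadratic in [t]; the decrease it brings,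
   [dot (f - g) w ^+ 2 / dot w w], must then be zero. *)
have := le_trans qg (key (- (dot (f - g) w / dot w w))); rewrite dotDZ//.
have -> : dot (f - g) (f - g) + 2 * - (dot (f - g) w / dot w w) * dot (f - g) w +
   (- (dot (f - g) w / dot w w)) ^+ 2 * dot w w
   = dot (f - g) (f - g) - dot (f - g) w ^+ 2 / dot w w by field.
have wp : 0 < dot w w by rewrite lt_neqAle eq_sym w0 dot_ge0.
rewrite -subr_ge0 addrAC subrr add0r oppr_ge0 pmulr_lle0 ?invr_gt0//.
by rewrite le_eqVlt ltNge sqr_ge0 orbF sqrf_eq0 => /eqP.
Unshelve. all: by end_near. Qed.

End hilbert_theory.

(** * Sums of reproducing kernel Hilbert spaces *)

Lemma cvgn_sum {R : realType} (I : Type) (s : seq I) (u : nat -> I -> R) (l : I -> R) :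
  (forall i, u n i @[n --> \oo] --> l i) ->
  (\sum_(i <- s) u n i) @[n --> \oo] --> \sum_(i <- s) l i.
Proof.
move=> ul; elim: s => [|i s IH].
  by rewrite big_nil; under eq_fun do rewrite big_nil; exact: cvg_cst.
by rewrite big_cons; under eq_fun do rewrite big_cons; exact: cvgD.
Qed.

(** [A] is an injective linear isometry into [H1], and the last hypothesis says that its range is
    closed, so completeness pulls back. It serves twice: with [lift] for the sum space and with
    [Hki_l2] for [Hki]. *)
Lemma hilbert_transfer {R : realType} {T1 T2 : Type} (H1 : @fun_space R T1)
    (H2 : @fun_space R T2) (A : (T2 -> R) -> T1 -> R) :
  is_hilbert H1 ->
  H2 0 ->
  (forall (a : R) f g, H2 f -> H2 g -> H2 (a *: f + g)) ->
  (forall f, H2 f -> H1 (A f)) ->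
  (forall (a : R) f g, H2 f -> H2 g -> A (a *: f + g) = a *: A f + A g) ->
  (forall f g, H2 f -> H2 g -> fs_dot H2 f g = fs_dot H1 (A f) (A g)) ->
  (forall f, H2 f -> A f = 0 -> f = 0) ->
  (forall u g, (forall n, H2 (u n)) -> H1 g -> fs_cvg H1 (A \o u) g ->
    exists2 f, H2 f & A f = g) ->
  is_hilbert H2.
Proof.
move=> hH1 H20 H2P HA AP dotA A0 Acl.
have H2B f g : H2 f -> H2 g -> H2 (f - g).
  by move=> Hf Hg; rewrite addrC -scaleN1r; exact: H2P.
have AB f g : H2 f -> H2 g -> A (f - g) = A f - A g.
  by move=> Hf Hg; rewrite addrC -scaleN1r AP// scaleN1r addrC.
have normA f g : H2 f -> H2 g -> fs_norm H2 (f - g) = fs_norm H1 (A f - A g).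
  by move=> Hf Hg; rewrite /fs_norm dotA ?AB//; exact: H2B.
split => //.
- by move=> f g Hf Hg; rewrite !dotA// (dot_sym hH1)//; exact: HA.
- by move=> a f g h Hf Hg Hh; rewrite !dotA ?AP ?(dot_linear hH1)//; [exact: HA..|exact: H2P].
- by move=> f Hf; rewrite dotA//; apply: (dot_ge0 hH1); exact: HA.
- by move=> f Hf; rewrite dotA// => /(dot_eq0 hH1 (HA _ Hf)); exact: A0.
- move=> u Hu ucau.
  have [e e0|g Hg ug] := hilbert_complete hH1 (u := A \o u) (fun n => HA _ (Hu n)).
    have := ucau e e0; apply: filterS => -[m n] /=; by rewrite normA.
  have [f Hf fg] := Acl _ _ Hu Hg ug.
  exists f => //; under eq_fun do rewrite normA//.
  by rewrite fg.
Qed.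

(** * Reproducing kernels and uniqueness of their spaces *)

Section rkhs_theory.
Context {R : realType} {T : Type}.
Implicit Types (k : T -> T -> R) (H : @fun_space R T) (f g : T -> R).

(** The quadratic form at [v] is the squared norm of the combination of the [k (x i)] with
    coefficients [v i 0]. *)
Lemma rkhs_kernel k H : is_rkhs_of k H -> is_kernel k.
Proof.
move=> [[hH _] Hk kE].
have ksym x y : k x y = k y x by rewrite !kE// (dot_sym hH).
split=> // n x _; split; first by apply/matrixP => i j; rewrite !mxE.
move=> v; pose f := \sum_(i < n) v i 0 *: k (x i).
suff -> : (v^T *m (\matrix_(i, j) k (x i) (x j)) *m v) 0 0 = fs_dot H f f.
  by apply: (dot_ge0 hH); apply: hilbert_sum => // i _; exact: hilbertZ.
have Hv i : true -> H (v i 0 *: k (x i)) by move=> _; exact: hilbertZ.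
rewrite dot_sumr//; last exact: hilbert_sum.
rewrite mxE; apply: eq_bigr => j _; rewrite mxE mulr_suml dot_suml//; last exact: Hv.
by apply: eq_bigr => i _; rewrite dotZl ?dotZr ?mxE -?kE//; [ring|exact: Hv].
Qed.

(** Combinations are lists of coefficient-point pairs, so that adding them is concatenation and
    points may repeat. *)
Definition kspan k : set (T -> R) :=
  [set f | exists s : seq (R * T), f = \sum_(c <- s) c.1 *: k c.2].

Lemma kspan_subspace k H : is_hilbert H -> (forall x, H (k x)) ->
  subspace_of H (kspan k).
Proof.
move=> hH Hk; split.
- by move=> _ [s ->]; apply: hilbert_sum => // c _; exact: hilbertZ.
- by exists [::]; rewrite big_nil.
- move=> a _ _ [s ->] [t ->]; exists ([seq (a * c.1, c.2) | c <- s] ++ t).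
  rewrite big_cat big_map /= scaler_sumr; congr (_ + _).
  by apply: eq_bigr => c _; rewrite scalerA.
Qed.

(** By the reproducing property both squared norms are the same double sum of values of [k]. *)
Lemma kspan_norm k H1 H2 f : is_rkhs_of k H1 -> is_rkhs_of k H2 -> kspan k f ->
  fs_norm H1 f = fs_norm H2 f.
Proof.
move=> rH1 rH2 [s ->]; rewrite /fs_norm; congr (Num.sqrt _).
suff dotE H : is_rkhs_of k H -> fs_dot H (\sum_(c <- s) c.1 *: k c.2)
   (\sum_(c <- s) c.1 *: k c.2) = \sum_(c <- s) \sum_(b <- s) b.1 * (c.1 * k b.2 c.2).
  by rewrite !dotE.
move=> [[hH _] Hk kE].
have HZ c : true -> H (c.1 *: k c.2) by move=> _; exact: hilbertZ.
rewrite dot_sumr//; last exact: hilbert_sum.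
apply: eq_bigr => c _; rewrite dot_suml//; last exact: HZ.
by apply: eq_bigr => b _; rewrite dotZl ?dotZr -?kE//; exact: HZ.
Qed.

Lemma rkhs_cvg_pointwise k H u f x : is_rkhs_of k H -> (forall n, H (u n)) -> H f ->
  fs_cvg H u f -> u n x @[n --> \oo] --> f x.
Proof.
move=> [[hH _] Hk kE] Hu Hf uf; rewrite kE//.
by under eq_fun do rewrite kE//; exact: (fs_cvg_dot hH).
Qed.

(* Finite combinations of the [k x] are dense, since a function orthogonal to all
   of them vanishes everywhere by the reproducing property. *)
Lemma kspan_dense k H f : is_rkhs_of k H -> H f ->
  exists2 u, (forall n : nat, kspan k (u n)) & fs_cvg H u f.
Proof.
move=> [[hH _] Hk kE] Hf.
have [u [g [Wu Hg ug fg]]] := hilbert_proj hH (kspan_subspace hH Hk) Hf.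
exists u => //; suff -> : f = g by [].
apply/funext => x; apply/eqP; rewrite -subr_eq0 !kE// -dotBl//; apply/eqP/fg.
by exists [:: (1, x)]; rewrite big_seq1 scale1r.
Qed.

(** Approximate [f] in [H1] by elements of [kspan k]. Their norms agree in both spaces, so they are
    Cauchy in [H2]; convergence in either norm is pointwise, which identifies the two limits. *)
Lemma rkhs_unique k H1 H2 f : is_rkhs_of k H1 -> is_rkhs_of k H2 ->
  H1 f -> H2 f /\ fs_norm H2 f = fs_norm H1 f.
Proof.
move=> rH1 rH2 H1f; have [u uW uf] := kspan_dense rH1 H1f.
have [[hH1 _] H1k _] := rH1; have [[hH2 _] H2k _] := rH2.
have [WH1 _ WP] := kspan_subspace hH1 H1k; have [WH2 _ _] := kspan_subspace hH2 H2k.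
have H1u n : H1 (u n) by exact: WH1.
have H2u n : H2 (u n) by exact: WH2.
have [e e0|g H2g ug] := hilbert_complete hH2 H2u.
  have := fs_cvg_cauchy hH1 H1u H1f uf e0; apply: filterS => -[m n] /=.
  rewrite (@kspan_norm k H1 H2)//.
  by rewrite addrC -scaleN1r; exact: WP.
have fg : f = g.
  apply/funext => x; have ux1 := rkhs_cvg_pointwise (x := x) rH1 H1u H1f uf.
  have ux2 := rkhs_cvg_pointwise (x := x) rH2 H2u H2g ug.
  by rewrite -(cvg_lim _ ux1)//; exact: (cvg_lim _ ux2).
rewrite fg; split => //; rewrite -fg in ug H2g *.
have n1 := fs_cvg_norm hH1 H1u H1f uf; have n2 := fs_cvg_norm hH2 H2u H2g ug.
have nE : (fun n => fs_norm H1 (u n)) = (fun n => fs_norm H2 (u n)).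
  by apply/funext => n; exact: (@kspan_norm k).
by rewrite nE in n1; rewrite -(cvg_lim _ n1)//; exact/esym/(cvg_lim _ n2).
Qed.

End rkhs_theory.

(** * Finite direct sums of Hilbert spaces of functions *)

Section direct_sum.
Context {R : realType} {T : Type} {n : nat} (H : 'I_n -> @fun_space R T).
Implicit Types F G : 'I_n * T -> R.

Definition slice F (i : 'I_n) : T -> R := fun x => F (i, x).

Definition dsum : @fun_space R ('I_n * T) := FunSpace
  (fun F => forall i, H i (slice F i))
  (fun F G => \sum_(i < n) fs_dot (H i) (slice F i) (slice G i)).

Definition total F : T -> R := fun x => \sum_(i < n) F (i, x).

Hypothesis hH : forall i, is_hilbert (H i).

Lemma dsum_norm_ge F i : dsum F -> fs_norm (H i) (slice F i) <= fs_norm dsum F.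
Proof.
move=> HF; rewrite ler_wsqrtr// /fs_dot/= (bigD1 i)//= lerDl.
by apply: sumr_ge0 => j _; exact: dot_ge0.
Qed.

Lemma dsum_hilbert : is_hilbert dsum.
Proof.
have dP a F G : dsum F -> dsum G -> dsum (a *: F + G).
  by move=> HF HG i; exact: (hilbertP (hH i) a (HF i) (HG i)).
split => //.
- by move=> i; exact: (hilbert0 (hH i)).
- by move=> F G HF HG; apply: eq_bigr => i _; exact: (dot_sym (hH i)).
- move=> a F G K HF HG HK; rewrite /= mulr_sumr -big_split; apply: eq_bigr => i _.
  exact: (dot_linear (hH i)).
- by move=> F HF; apply: sumr_ge0 => i _; exact: (dot_ge0 (hH i)).
- move=> F HF /eqP; rewrite psumr_eq0; last by move=> i _; exact: (dot_ge0 (hH i)).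
  move=> /allP F0; apply/funext => -[i x].
  have /eqP/(dot_eq0 (hH i) (HF i)) := F0 i (mem_index_enum _).
  by move=> /(congr1 (fun f => f x)).
- move=> u Hu ucau.
  (* Componentwise limits exist because each component norm is at most the norm in [dsum]. *)
  have /choice[g gP] : forall i, exists g, H i g /\ fs_cvg (H i) (fun m => slice (u m) i) g.
    move=> i.
    have [e e0|g Hg ug] := hilbert_complete (hH i) (u := fun m => slice (u m) i) (fun m => Hu m i).
      have := ucau e e0; apply: filterS => -[m p] /=; apply: le_lt_trans.
      apply: (@dsum_norm_ge (u m - u p)) => j.
      exact: (hilbertB (hH j) (Hu m j) (Hu p j)).
    by exists g.
  exists (fun ix => g ix.1 ix.2) => [i|]; first by case: (gP i).
  rewrite /fs_norm -[X in _ --> X]sqrtr0; apply: continuous_cvg.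
    exact: sqrt_continuous.
  rewrite /=; rewrite [X in _ --> X](_ : _ = \sum_(i < n) 0); last by rewrite big1.
  apply: cvgn_sum => i.
  have [Hg ug] := gP i.
  have Hv m : H i (slice (u m) i - g i) by exact: (hilbertB (hH i) (Hu m i) Hg).
  rewrite (_ : (fun m => _) = (fun m => fs_norm (H i) (slice (u m) i - g i) ^+ 2)).
    by rewrite -[X in _ --> X](mulr0 0); exact: cvgM.
  by apply/funext => m; rewrite (fs_normsq (hH i)).
Qed.

Lemma sum_set_total f : sum_set H f <-> exists2 F, dsum F & total F = f.
Proof.
split=> [[g Hg ->]|[F HF <-]].
  exists (fun ix => g ix.1 ix.2) => //.
  by apply/funext => x; rewrite /total/= fct_sumE.
exists (slice F) => //; apply/funext => x; by rewrite /total fct_sumE.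
Qed.

End direct_sum.

(** * Aronszajn's space for a finite sum of kernels *)

Section rkhs_sum.
Context {R : realType} {T : Type} {n : nat} (H : 'I_n -> @fun_space R T).
Variable K : 'I_n -> T -> T -> R.
Hypothesis rH : forall i, is_rkhs_of (K i) (H i).
Implicit Types (f g : T -> R) (F G : 'I_n * T -> R).

Let hH i : is_hilbert (H i). Proof. by have [[]] := rH i. Qed.
Let hS : is_hilbert (dsum H) := dsum_hilbert hH.

(** Feature map of the sum kernel: pairing with [feature x] evaluates the total at [x]. *)
Definition feature (x : T) : 'I_n * T -> R := fun iy => K iy.1 x iy.2.

Lemma feature_dsum x : dsum H (feature x).
Proof. by move=> i; have [_ + _] := rH i; exact. Qed.

Lemma total_feature F x : dsum H F -> total F x = fs_dot (dsum H) F (feature x).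
Proof.
move=> HF; apply: eq_bigr => i _; have [_ _ kE] := rH i.
exact: (kE (slice F i) (HF i) x).
Qed.

Lemma totalP (a : R) F G : total (a *: F + G) = a *: total F + total G.
Proof.
apply/funext => x; rewrite !fctE /total /= scaler_sumr -big_split.
by apply: eq_bigr.
Qed.

Definition null : set ('I_n * T -> R) := [set F | dsum H F /\ total F = 0].

Lemma null_subspace : subspace_of (dsum H) null.
Proof.
split=> [F []//||a F G [HF F0] [HG G0]].
  by split; [exact: (hilbert0 hS)|apply/funext => x; rewrite /total big1].
by split; [exact: (hilbertP hS)|rewrite totalP F0 G0 scaler0 addr0].
Qed.

(** [null] is cut out by the pairings with the [feature x], which are continuous functionals. *)
Lemma null_closed u F : (forall m : nat, null (u m)) -> dsum H F ->
  fs_cvg (dsum H) u F -> null F.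
Proof.
move=> Nu HF uF; have Hu m : dsum H (u m) by case: (Nu m).
split => //; apply/funext => x.
have := fs_cvg_dot hS Hu HF (feature_dsum x) uF.
under eq_fun do rewrite -total_feature// (proj2 (Nu _)).
by rewrite -total_feature// => h; rewrite -(cvg_lim _ h)// lim_cst.
Qed.

Definition is_lift f F := [/\ dsum H F, total F = f &
  forall G, null G -> fs_dot (dsum H) F G = 0].

(** Subtract from any preimage its projection onto [null]; as [null] is closed, that projection lies
    in it and does not affect the total. *)
Lemma lift_exists f : sum_set H f -> exists F, is_lift f F.
Proof.
move=> /sum_set_total[F HF <-].
have [u [G [Nu HG uG FG]]] := hilbert_proj hS null_subspace HF.
have [_ G0] := null_closed Nu HG uG.
exists (F - G); split => //; first exact: (hilbertB hS).
by rewrite addrC -scaleN1r totalP G0 scaler0 add0r.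
Qed.

Lemma lift_unique f F G : is_lift f F -> is_lift f G -> F = G.
Proof.
move=> [HF Ff F0] [HG Gf G0]; have HFG := hilbertB hS HF HG.
have NFG : null (F - G).
  by split => //; rewrite addrC -scaleN1r totalP Ff Gf scaleN1r addNr.
apply/eqP; rewrite -subr_eq0; apply/eqP/(dot_eq0 hS HFG).
by rewrite (dotBl hS)// F0// G0// subrr.
Qed.

Lemma lift_linear (a : R) f g F G : is_lift f F -> is_lift g G ->
  is_lift (a *: f + g) (a *: F + G).
Proof.
move=> [HF Ff F0] [HG Gf G0]; split; first exact: (hilbertP hS).
  by rewrite totalP Ff Gf.
move=> K0 NK; have [HK _] := NK.
by rewrite (dot_linear hS)// F0// G0// mulr0 addr0.
Qed.

(** Pythagoras: [G - F] lies in [null], hence is orthogonal to [F]. *)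
Lemma lift_min f F G : is_lift f F -> dsum H G -> total G = f ->
  fs_dot (dsum H) F F <= fs_dot (dsum H) G G.
Proof.
move=> [HF Ff F0] HG Gf; have HGF := hilbertB hS HG HF.
have NFG : null (G - F).
  by split => //; rewrite addrC -scaleN1r totalP Ff Gf scaleN1r addNr.
have := dotDZ hS 1 HF HGF; rewrite (F0 _ NFG) scale1r (addrC F) subrK => ->.
by rewrite mulr0 addr0 expr1n mul1r lerDl (dot_ge0 hS).
Qed.

(** The default 0 is reached only outside [sum_set H], where no lift exists. *)
Definition lift f := xget 0 [set F | is_lift f F].

Lemma liftP f : sum_set H f -> is_lift f (lift f).
Proof. by move=> /lift_exists[F FP]; apply: (xgetPex 0); exists F. Qed.

Lemma liftE f F : is_lift f F -> lift f = F.
Proof. by move=> FP; apply: (@lift_unique f) => //; apply: (xgetPex 0); exists F. Qed.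

Definition rkhs_sum : @fun_space R T :=
  FunSpace (sum_set H) (fun f g => fs_dot (dsum H) (lift f) (lift g)).

(** Pairing with [feature x] evaluates the total, which vanishes on [null]; hence the
    orthogonality. *)
Lemma lift_feature x : is_lift (fun y => \sum_(i < n) K i x y) (feature x).
Proof.
split => //; first exact: feature_dsum.
move=> G [HG G0]; rewrite (dot_sym hS)//; last exact: feature_dsum.
by rewrite -total_feature// G0.
Qed.

Lemma lift_sum_set f F : is_lift f F -> sum_set H f.
Proof. by move=> [HF Ff _]; apply/sum_set_total; exists F. Qed.

Lemma rkhs_sumP : is_rkhs_of (fun x y => \sum_(i < n) K i x y) rkhs_sum.
Proof.
have hil : is_hilbert rkhs_sum.
  apply: (@hilbert_transfer _ _ _ (dsum H) _ lift) => //=.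
  - by apply/sum_set_total; exists 0; [exact: (hilbert0 hS)|apply/funext => x; rewrite /total big1].
  - by move=> a f g /liftP Lf /liftP Lg; exact: lift_sum_set (lift_linear a Lf Lg).
  - by move=> f /liftP[].
  - by move=> a f g /liftP Lf /liftP Lg; exact: liftE (lift_linear a Lf Lg).
  - by move=> f /liftP[_ Lf _] L0; rewrite -Lf L0; apply/funext => x; rewrite /total big1.
  (* Closed range: orthogonality to [null] survives in the limit, so [F] is the lift of its own
     total. *)
  - move=> u F Su HF uF; have Lu m : is_lift (u m) (lift (u m)) by exact: liftP.
    have FL : is_lift (total F) F.
      split => // G NG; have [HG _] := NG.
      have Hu m : dsum H (lift (u m)) by case: (Lu m).
      have := fs_cvg_dot hS Hu HF HG uF.
      have -> : (fun m => fs_dot (dsum H) ((lift \o u) m) G) = (fun=> 0).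
        by apply/funext => m; case: (Lu m) => _ _; exact.
      by move=> h; rewrite -(cvg_lim _ h)// lim_cst.
    by exists (total F); [exact: lift_sum_set FL|exact: liftE].
have kE f x : sum_set H f ->
    f x = fs_dot rkhs_sum f (fun y => \sum_(i < n) K i x y).
  by move=> /liftP[Hf Lf _]; rewrite -{1}Lf total_feature//= (liftE (lift_feature x)).
have Hk x : rkhs_sum (fun y => \sum_(i < n) K i x y).
  exact: lift_sum_set (lift_feature x).
split => //; last by move=> f Hf x; exact: kE.
split => // x; exists (fs_norm rkhs_sum (fun y => \sum_(i < n) K i x y)) => f Hf.
by rewrite kE// mulrC; exact: dot_CS.
Qed.

Lemma rkhs_sum_min f : sum_set H f ->
  is_min (sum_normsq_set H f) (fs_norm rkhs_sum f ^+ 2).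
Proof.
move=> Sf; have [[hil _] _ _] := rkhs_sumP; rewrite (fs_normsq hil)//=.
have dsumE F : dsum H F ->
    fs_dot (dsum H) F F = \sum_(i < n) fs_norm (H i) (slice F i) ^+ 2.
  by move=> HF; apply: eq_bigr => i _; rewrite (fs_normsq (hH i)).
have Lf := liftP Sf; split.
  have [HF Ff _] := Lf; exists (slice (lift f)); split => //; last exact: dsumE.
  by rewrite -[LHS]Ff; apply/funext => x; rewrite fct_sumE.
move=> _ [g [Hg fg ->]]; pose G : 'I_n * T -> R := fun ix => g ix.1 ix.2.
apply: (@le_trans _ _ (fs_dot (dsum H) G G)); last by rewrite dsumE.
by apply: (lift_min Lf) => //; rewrite fg; apply/funext => x; rewrite fct_sumE.
Qed.

Lemma rkhs_sum_unique (Hk : @fun_space R T) :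
  is_rkhs_of (fun x y => \sum_(i < n) K i x y) Hk ->
  fs_set Hk = sum_set H /\
  forall f, Hk f -> is_min (sum_normsq_set H f) (fs_norm Hk f ^+ 2).
Proof.
move=> rk; split.
  apply/seteqP; split => f Hf.
    by have [] := rkhs_unique rk rkhs_sumP Hf.
  by have [] := rkhs_unique (f := f) rkhs_sumP rk Hf.
move=> f Hf; have [Sf <-] := rkhs_unique rk rkhs_sumP Hf.
exact: rkhs_sum_min.
Qed.

End rkhs_sum.

(** * Square-summable sequences *)

Section nonneg_series.
Context {R : realType}.
Implicit Types (u : nat -> R) (M : R).

Lemma series_le_lim u n : (forall m, 0 <= u m) -> cvgn (series u) ->
  series u n <= limn (series u).
Proof.
move=> u0 cu; apply: nondecreasing_cvgn_le => //.
by apply: nondecreasing_series => m _ _.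
Qed.

Lemma series_bounded_cvg u M : (forall m, 0 <= u m) ->
  (forall n, series u n <= M) -> cvgn (series u) /\ limn (series u) <= M.
Proof.
move=> u0 uM; have cu : cvgn (series u).
  apply: nondecreasing_is_cvgn; first by apply: nondecreasing_series => m _ _.
  by exists M => _ [n _ <-].
by split => //; apply: limr_le => //; near=> n.
Unshelve. all: by end_near. Qed.

(** Bridge between the extended-real sums in [Hki_set] and convergence of series in [R]. *)
Lemma nneseries_lty u : (forall m, 0 <= u m) ->
  (\sum_(0 <= m <oo) (u m)%:E < +oo)%E <-> cvgn (series u).
Proof.
move=> u0; split=> [us|cu].
  have [|//] := @series_bounded_cvg u (fine (\sum_(0 <= m <oo) (u m)%:E)%E) u0.
  move=> n; rewrite -lee_fin fineK; last first.
    by rewrite ge0_fin_numE//; apply: nneseries_ge0 => m _ _; rewrite lee_fin.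
  rewrite /series/= -sumEFin; apply: nneseries_lim_ge => m _ _.
  by rewrite lee_fin.
apply: le_lt_trans (ltry (limn (series u))).
apply: lime_le; first by apply: is_cvg_nneseries => m _ _; rewrite lee_fin.
by near=> n; rewrite sumEFin lee_fin; exact: series_le_lim.
Unshelve. all: by end_near. Qed.

End nonneg_series.

Section l2.
Context {R : realType}.
Implicit Types (a b c : nat -> R).

Definition l2 : @fun_space R nat := FunSpace
  (fun a => cvgn (series (fun m => a m ^+ 2)))
  (fun a b => limn (series (fun m => a m * b m))).

Lemma l2_mul a b : l2 a -> l2 b -> cvgn (series (fun m => a m * b m)).
Proof.
move=> la lb; apply: normed_cvg => /=.
apply: (@series_le_cvg _ _ ((fun m => a m ^+ 2) + (fun m => b m ^+ 2))) => //=.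
- by move=> n; rewrite addr_ge0 ?sqr_ge0.
- move=> n; rewrite !fctE normrM -(real_normK (num_real (a n))) -(real_normK (num_real (b n))).
  have := sqr_ge0 (`|a n| - `|b n|); rewrite sqrrB.
  have := sqr_ge0 (`|a n|); have := sqr_ge0 (`|b n|); nra.
- exact: is_cvg_seriesD.
Qed.

Lemma l2P (x : R) a b : l2 a -> l2 b -> l2 (x *: a + b).
Proof.
(* Majorant from [(s + t) ^+ 2 <= 2 * s ^+ 2 + 2 * t ^+ 2]. *)
move=> la lb; apply: (@series_le_cvg _ _
  ((2 * x ^+ 2) *: (fun m => a m ^+ 2) + 2 *: (fun m => b m ^+ 2))) => [n|n|n|].
- exact: sqr_ge0.
- by rewrite addr_ge0// mulr_ge0 ?sqr_ge0// mulr_ge0// sqr_ge0.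
- rewrite !fctE /GRing.scale /=; have := sqr_ge0 (x * a n - b n); nra.
- by apply: is_cvg_seriesD; exact: is_cvg_seriesZ.
Qed.

Lemma l2_dot_linear (x : R) a b c : l2 a -> l2 b -> l2 c ->
  fs_dot l2 (x *: a + b) c = x * fs_dot l2 a c + fs_dot l2 b c.
Proof.
move=> la lb lc; rewrite /=.
rewrite (_ : (fun m => _) = x *: (fun m => a m * c m) + (fun m => b m * c m)).
  have lac := l2_mul la lc; have lbc := l2_mul lb lc.
  by rewrite (lim_seriesD (@is_cvg_seriesZ _ _ x lac) lbc) (lim_seriesZ x lac).
by apply/funext => m; rewrite !fctE /GRing.scale /=; ring.
Qed.

Lemma l2_normsq_ge a m : l2 a -> a m ^+ 2 <= fs_dot l2 a a.
Proof.
move=> la; apply: (@le_trans _ _ (series (fun m => a m ^+ 2) m.+1)).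
  rewrite /series /= big_nat_recr//= lerDr.
  by apply: sumr_ge0 => i _; exact: sqr_ge0.
apply: series_le_lim => // i; exact: sqr_ge0.
Qed.

Lemma l2_hilbert : is_hilbert l2.
Proof.
have l20 : l2 0.
  rewrite /= (_ : (fun m => _) = 0); last by apply/funext => m; rewrite expr0n.
  rewrite (_ : series 0 = fun=> 0); first exact: is_cvg_cst.
  by apply/funext => n; rewrite /series /= big1.
have l2B a b : l2 a -> l2 b -> l2 (a - b).
  by move=> la lb; rewrite addrC -scaleN1r; exact: l2P.
split => //.
- exact: l2P.
- by move=> a b _ _ /=; congr (limn (series _)); apply/funext => m; rewrite mulrC.
- exact: l2_dot_linear.
- move=> a la; apply: limr_ge => //; near=> n; apply: sumr_ge0 => i _; exact: sqr_ge0.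
- move=> a la a0; apply/funext => m; have := l2_normsq_ge m la; rewrite a0.
  by rewrite le_eqVlt ltNge sqr_ge0 orbF sqrf_eq0 => /eqP.
move=> u lu ucau.
have nge0 a : l2 a -> 0 <= fs_dot l2 a a.
  by move=> la; exact: le_trans (sqr_ge0 _) (l2_normsq_ge 0 la).
have norm_lt a e : 0 < e -> l2 a -> fs_norm l2 a < e -> fs_dot l2 a a < e ^+ 2.
  by move=> e0 la; rewrite -(sqr_sqrtr (nge0 _ la)) ltr_pXn2r ?nnegrE ?sqrtr_ge0// ltW.
(* Each coordinate is dominated by the norm, hence is a Cauchy sequence of reals. *)
have ptw m : exists x : R, u n m @[n --> \oo] --> x.
  suff : cvgn (fun n => u n m) by move=> /cvg_ex.
  apply/cauchy_cvgP/cauchy_ballP => e e0; rewrite near_map2.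
  have := ucau _ e0; apply: filterS => -[p q] /= pq.
  rewrite /ball/= -(@ltr_pXn2r _ 2) ?nnegrE// ?ltW// real_normK ?num_real//.
  apply: le_lt_trans (norm_lt _ _ e0 _ pq); last exact: l2B.
  exact: (l2_normsq_ge m (l2B _ _ (lu p) (lu q))).
have [g gP] := choice ptw.
(* For fixed [p], let [q] go to infinity in each partial sum of the squared norm of [u p - u q];
   this gives membership and the bound together. *)
have tail e : 0 < e -> \forall p \near \oo,
    l2 (u p - g) /\ fs_norm l2 (u p - g) <= e.
  move=> e0; have [[P Q] /= [Poo Qoo] PQ] := ucau _ e0.
  apply: filterS Poo => p Pp.
  have [||cg lg] := @series_bounded_cvg _ (fun m => (u p - g) m ^+ 2) (e ^+ 2).
  - by move=> m; exact: sqr_ge0.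
  - move=> n.
    have cn : series (fun m => (u p - u q) m ^+ 2) n @[q --> \oo] -->
              series (fun m => (u p - g) m ^+ 2) n.
      apply: cvgn_sum => m; rewrite !fctE.
      have h : u p m - u q m @[q --> \oo] --> u p m - g m by apply: cvgB => //; exact: cvg_cst.
      by rewrite expr2; under eq_fun do rewrite expr2; exact: cvgM.
    apply: (cvgr_to_le cn); apply: filterS Qoo => q Qq.
    apply: le_trans (ltW (norm_lt _ _ e0 (l2B _ _ (lu p) (lu q)) (PQ (p, q) (conj Pp Qq)))).
    by apply: series_le_lim => [m|]; [exact: sqr_ge0|exact: l2B].
  split => //; rewrite -(@ler_pXn2r _ 2) ?nnegrE ?sqrtr_ge0 ?(ltW e0)//.
  rewrite sqr_sqrtr; last exact: (nge0 _ cg). exact: lg.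
have lg : l2 g.
  have [p _ /(_ _ (leqnn p))[lp _]] := tail _ (@ltr01 R).
  have -> : g = u p - (u p - g) by rewrite opprB addrC subrK.
  exact: l2B.
exists g => //; apply/cvgrPdist_le => e e0; have := tail _ e0; apply: filterS => p [_].
by rewrite sub0r normrN ger0_norm// sqrtr_ge0.
Unshelve. all: by end_near. Qed.

End l2.

(** * Entire power series on the half-line *)

Section deriv_halfline.
Context {R : realType}.
Implicit Types (f : Rp R -> R) (x y : Rp R) (F dF : R -> R).

Lemma val_Rp_continuous : continuous (fun x : Rp R => \val x).
Proof. by have := @initial_continuous (Rp R) R set_val; rewrite set_valE. Qed.

Lemma Rp_ge0 x : 0 <= \val x.
Proof. exact: (set_valP x). Qed.

Lemma val_toRp (r : R) : 0 <= r -> \val (toRp r) = r.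
Proof. by move=> r0; rewrite /toRp insubdK// inE. Qed.

(** Allows [\val y - \val x] as increment in an ordinary difference quotient; injectivity of [\val]
    keeps it nonzero. *)
Lemma cvg_subr_dnbhs x : (\val y - \val x) @[y --> x^'] --> (0 : R)^'.
Proof.
move=> A [e /= e0 eA]; rewrite /nbhs/= /dnbhs /within/=.
have := @val_Rp_continuous x; move=> /cvgrPdist_lt/(_ _ e0); apply: filterS => y xy yx.
apply: eA => /=; first by rewrite /ball/= sub0r normrN distrC.
by rewrite subr_eq0; apply: contra_neq yx => /val_inj.
Qed.

(** A point slightly to the right of [x] stays in the half-line, even at 0, so no point is isolated;
    this makes the limit in [deriv_Rp] unique. *)
Lemma dnbhs_Rp_proper x : ProperFilter x^'.
Proof.
apply: Build_ProperFilter_ex => A; rewrite /dnbhs /within /= => -[_ /= [[W oW <-] /= Wx WA]].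
rewrite set_valE in Wx WA.
have [e /= e0 eW] : nbhs (\val x) W by exact: open_nbhs_nbhs.
have xe0 : 0 <= \val x + e / 2 by rewrite addr_ge0 ?Rp_ge0// divr_ge0// ltW.
exists (toRp (\val x + e / 2)); apply: WA => /=.
  rewrite val_toRp//; apply: eW; rewrite /ball/= opprD addrA subrr sub0r normrN.
  by rewrite gtr0_norm ?divr_gt0// gtr_pMr// invf_lt1// ltr1n.
apply/eqP => /(congr1 \val); rewrite val_toRp// -[RHS]addr0 => /addrI/eqP.
by rewrite gt_eqF// divr_gt0.
Qed.

Lemma cvg_dquot F x (D : R) : is_derive (\val x) 1 F D ->
  dquot (F \o \val) x y @[y --> x^'] --> D.
Proof.
move=> FD; have dF : derivable F (\val x) 1 by [].
have lF : h^-1 *: (F (h *: 1 + \val x) - F (\val x)) @[h --> (0 : R)^'] --> D.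
  by rewrite -(@derive_val _ _ _ _ _ _ _ FD); exact: dF.
have := cvg_comp _ _ (@cvg_subr_dnbhs x) lF; apply: cvg_trans.
apply: near_eq_cvg; near=> y.
by rewrite /dquot /= /GRing.scale /= mulr1 subrK mulrC.
Unshelve. all: by end_near. Qed.

Lemma derivable_Rp_val F dF x : (forall r : R, is_derive r 1 F (dF r)) ->
  derivable_Rp (F \o \val) x.
Proof. by move=> FD; apply/cvg_ex; exists (dF (\val x)); exact: cvg_dquot. Qed.

Lemma deriv_Rp_val F dF : (forall r : R, is_derive r 1 F (dF r)) ->
  deriv_Rp (F \o \val) = dF \o \val.
Proof.
move=> FD; apply/funext => x; have xP := dnbhs_Rp_proper x.
by apply/cvg_lim => //; exact: cvg_dquot.
Qed.

End deriv_halfline.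

(** * Termwise differentiation of everywhere convergent power series *)

Section entire_series.
Context {R : realType}.
Implicit Types (c : nat -> R).

Definition entire c := forall r : R, cvgn (pseries c r).

Definition psum c (r : R) : R := limn (pseries c r).

(** With [s] equal to 1 plus the absolute value of [r], the factor [n.+1] is at most [2 ^+ n.+1] and
    the power of [r] at most [s ^+ n.+1] in absolute value, so absolute convergence at [2 * s]
    suffices. *)
Lemma entire_diffs c : entire c -> entire (pseries_diffs c).
Proof.
move=> cE r; pose s : R := `|r| + 1.
have s1 : 1 <= s by rewrite /s lerDr.
have s0 : 0 <= s by exact: le_trans s1.
have cs : cvgn (pseries (fun i => `|c i|) (2 * s)).
  apply: is_cvg_pseries_inside_norm (cE (2 * s + 1)) _.
  by rewrite !ger0_norm ?ltrDl ?addr_ge0 ?mulr_ge0.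
have {}cs : cvgn (series (fun i => `|c i.+1| * (2 * s) ^+ i.+1)).
  rewrite (_ : series _ = (fun n => pseries (fun i => `|c i|) (2 * s) n.+1 - `|c 0%N|)).
    move: cs => /cvg_ex[l]; rewrite -cvg_shiftS => cl.
    by apply/cvg_ex; exists (l - `|c 0%N|); apply: cvgB => //; exact: cvg_cst.
  apply/funext => n; rewrite /pseries /series /= big_nat_recl//= expr0 mulr1.
  by rewrite addrC addKr.
apply: normed_cvg => /=; apply: series_le_cvg cs => n //=.
  by rewrite mulr_ge0// exprn_ge0// mulr_ge0.
rewrite /pseries_diffs !normrM normrX normr_nat mulrAC mulrC exprMn.
apply: ler_wpM2l => //; apply: ler_pM => //.
- by rewrite -natrX ler_nat ltnW// ltn_expl.
- apply: (@le_trans _ _ (s ^+ n)); first by rewrite lerXn2r ?nnegrE ?lerDl.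
  by rewrite exprS ler_peMl ?exprn_ge0.
Qed.

Lemma entire_iter_diffs c m : entire c -> entire (iter m (@pseries_diffs R) c).
Proof. by move=> cE; elim: m => //= m; exact: entire_diffs. Qed.

Lemma is_derive_psum c (r : R) : entire c ->
  is_derive r 1 (psum c) (psum (pseries_diffs c) r).
Proof.
(* Termwise differentiation asks for convergence of the series and of its first two formal
   derivatives at a radius beyond [r]. *)
move=> cE; apply: (@pseries_snd_diffs _ _ (`|r| + 1)); first exact: cE.
- exact: entire_diffs.
- by apply: entire_diffs; exact: entire_diffs.
- by rewrite [X in _ < X]ger0_norm ?addr_ge0// ltrDl.
Qed.

Lemma is_derive_psum_shift c (r0 r : R) : entire c ->
  is_derive r 1 (fun s => psum c (s - r0)) (psum (pseries_diffs c) (r - r0)).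
Proof.
move=> cE; have := @is_derive1_comp _ _ _ r _ _
  (is_derive_psum (r - r0) cE) (is_derive_shift r 1 (- r0)).
by rewrite mulr1.
Qed.

Lemma psum0 c : psum c 0 = c 0%N.
Proof.
apply: cvg_lim => //; rewrite -(cvg_shiftS _ (nbhs (c 0%N))).
rewrite (_ : (fun n => _) = (fun=> c 0%N)); first exact: cvg_cst.
apply/funext => n; rewrite /pseries /series /= big_nat_recl//= expr0 mulr1.
by rewrite big1 ?addr0// => i _; rewrite expr0n mulr0.
Qed.

Lemma iter_diffs0 c m : iter m (@pseries_diffs R) c 0%N = m`!%:R * c m.
Proof.
elim: m c => [c|m IH c]; first by rewrite mul1r.
by rewrite iterSr IH /pseries_diffs factS natrM; ring.
Qed.

(** As [alpha / beta] is nonnegative, [toRp] leaves the center unchanged; iterated termwise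
    differentiation then isolates one coefficient. *)
Lemma dcenter_psum c (alpha beta : R) (f : Rp R -> R) m :
  0 <= alpha -> 0 < beta -> entire c ->
  f = (fun r => psum c (r - alpha / beta)) \o \val ->
  dcenter alpha beta f m = m`!%:R * c m.
Proof.
move=> alpha0 beta0 cE fE.
have -> : dcenter alpha beta f m =
    psum (iter m (@pseries_diffs R) c) (\val (toRp (alpha / beta)) - alpha / beta).
  rewrite /dcenter; move: (toRp _) => x.
  suff -> : iter m deriv_Rp f =
      (fun r => psum (iter m (@pseries_diffs R) c) (r - alpha / beta)) \o \val by [].
  elim: m => //= m ->; apply: deriv_Rp_val => r.
  by apply: is_derive_psum_shift; exact: entire_iter_diffs.
by rewrite val_toRp ?divr_ge0// ?(ltW beta0)// subrr psum0 iter_diffs0.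
Qed.

End entire_series.

(** * The spaces of the kernels [ki] *)

Lemma cvg_series0 {R : realType} (u : nat -> R) : (forall m, u m = 0) ->
  series u n @[n --> \oo] --> (0 : R).
Proof.
move=> u0; rewrite (_ : series u = fun=> 0); first exact: cvg_cst.
by apply/funext => n; rewrite /series /= big1.
Qed.

(** The coefficient is [1 / (m - l)!] for [m >= l] and zero below, so a shift by [l] leaves [t ^+ l]
    times the exponential series. *)
Lemma cvg_falling_exp_series {R : realType} (l : nat) (t : R) :
  series (fun m => 'C(m, l)%:R * l`!%:R / m`!%:R * t ^+ m) n @[n --> \oo] -->
  t ^+ l * expR t.
Proof.
rewrite -(cvg_shiftn l _ (nbhs (t ^+ l * expR t))).
rewrite (_ : (fun n => _) = (fun n => t ^+ l * series (exp_coeff t) n)).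
  by apply: cvgM; [exact: cvg_cst|exact: is_cvg_series_exp_coeff].
apply/funext => n; rewrite /series /= (@big_cat_nat _ _ _ l) ?leq_addl//=.
rewrite big_nat_cond big1 ?add0r; last first.
  by move=> m /andP[/andP[_ ml] _]; rewrite bin_small// !mul0r.
rewrite -{1}[l]add0n big_addn addnK mulr_sumr; apply: eq_bigr => j _.
have /(congr1 (fun n => n%:R : R)) := bin_fact (leq_addl j l); rewrite addnK => E.
have j0 : j`!%:R != 0 :> R by rewrite pnatr_eq0 -lt0n fact_gt0.
have jl0 : (j + l)`!%:R != 0 :> R by rewrite pnatr_eq0 -lt0n fact_gt0.
rewrite /exp_coeff /= -E !natrM in jl0 *.
have C0 : 'C(j + l, l)%:R != 0 :> R by apply: contraNneq jl0 => ->; rewrite mul0r.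
have l0 : l`!%:R != 0 :> R by rewrite pnatr_eq0 -lt0n fact_gt0.
by rewrite exprD; field; rewrite C0 l0 j0.
Qed.

Section Hki_rkhs.
Context {R : realType} (p : {poly R}) (alpha beta : R).
Hypotheses (p_ge0 : forall l, 0 <= p`_l) (alpha_ge0 : 0 <= alpha) (beta_gt0 : 0 < beta).
Implicit Types (f g : Rp R -> R) (a c : nat -> R).
Local Notation h := (hcoef p alpha beta).
Local Notation w := (Hweight p alpha beta).
Local Notation r0 := (alpha / beta).
Local Notation d := (dcenter alpha beta).

(* [ki x y = \sum_m kcoef m * (u v) ^+ m], so the squared norm of [\sum_m c m u ^+ m]
   in [Hki] is the sum of the [c m ^+ 2 / kcoef m]. *)
Definition kcoef m : R := h m * beta ^+ m / m`!%:R.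

Lemma hcoef_ge0 m : 0 <= h m.
Proof.
rewrite mulr_ge0 ?expR_ge0// sumr_ge0// => l _.
by rewrite mulr_ge0// mulr_ge0.
Qed.

Let fact0 m : 0 < m`!%:R :> R. Proof. by rewrite ltr0n fact_gt0. Qed.

Lemma kcoef_ge0 m : 0 <= kcoef m.
Proof. by rewrite divr_ge0 ?ler0n// mulr_ge0 ?hcoef_ge0// exprn_ge0// ltW. Qed.

Lemma hcoef_eq0 m : h m <= 0 -> h m = 0.
Proof. by move=> hm; apply/eqP; rewrite eq_le hm hcoef_ge0. Qed.

(** Where [h m] is positive the weight inverts [kcoef m] up to factorials; elsewhere it is 0 by
    convention. This cancellation yields the reproducing property. *)
Lemma Hweight_kcoef m : w m * m`!%:R ^+ 2 * kcoef m = (0 < h m)%R%:R.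
Proof.
rewrite /Hweight /wcoef /kcoef; have [hm|hm] := boolP (0 < h m); last by rewrite !mul0r.
have b0 : beta ^+ m != 0 by rewrite expf_neq0// gt_eqF.
rewrite [RHS](_ : _ = 1)//; move: (gt_eqF hm) (gt_eqF (fact0 m)) b0; move: (h m) => H H0 f0 b0.
by field; rewrite b0 H0 f0.
Qed.

Lemma wcoef_ge0 m : 0 <= wcoef p alpha beta m.
Proof. by rewrite /wcoef; case: ifP => // hm; rewrite invr_ge0 ltW. Qed.

Lemma Hweight_ge0 m : 0 <= w m.
Proof.
by rewrite divr_ge0 ?wcoef_ge0// mulr_ge0// exprn_ge0// ltW.
Qed.

Lemma Hweight_eq0 m : h m = 0 -> w m = 0.
Proof. by move=> hm; rewrite /Hweight /wcoef hm ltxx mul0r. Qed.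

(** Binomials with [l > m] vanish, so the range can be made independent of [m]; [cvg_kcoef_series]
    needs this to exchange sums. *)
Lemma hcoefE m : h m = expR (- (alpha ^+ 2 / beta)) *
  \sum_(l < (size p).-1.+1) 'C(m, l)%:R * l`!%:R * p`_l.
Proof.
rewrite /hcoef; congr (_ * _).
rewrite -(big_mkord xpredT (fun l => 'C(m, l)%:R * l`!%:R * p`_l)).
rewrite [RHS](@big_cat_nat _ _ _ (minn m (size p).-1).+1) ?ltnS ?geq_minr//=.
rewrite [X in _ = _ + X]big_nat_cond [X in _ = _ + X]big1 ?addr0// => l.
rewrite andbT ltnS gtn_min => /andP[/orP[ml _|]]; first by rewrite bin_small// !mul0r.
by move=> /leq_trans/[apply]; rewrite ltnn.
Qed.

Lemma cvg_kcoef_series (t : R) :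
  series (fun m => kcoef m * t ^+ m) n @[n --> \oo] -->
  expR (- (alpha ^+ 2 / beta)) * (p.[beta * t] * expR (beta * t)).
Proof.
rewrite (@horner_coef_wide _ (size p).-1.+1) ?leqSpred// mulr_suml.
rewrite (_ : series _ = (fun n => expR (- (alpha ^+ 2 / beta)) *
  \sum_(l < (size p).-1.+1) p`_l *
    series (fun m => 'C(m, l)%:R * l`!%:R / m`!%:R * (beta * t) ^+ m) n)).
  apply: cvgM; first exact: cvg_cst.
  apply: cvgn_sum => l; rewrite -mulrA; apply: cvgM; first exact: cvg_cst.
  exact: cvg_falling_exp_series.
apply/funext => n; rewrite /series /=.
under [in RHS]eq_bigr do rewrite mulr_sumr.
rewrite exchange_big mulr_sumr; apply: eq_bigr => m _.
rewrite /kcoef hcoefE -!mulrA; congr (_ * _).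
rewrite mulr_suml; apply: eq_bigr => l _; rewrite exprMn; ring.
Qed.

Lemma cvg_ki_series (x y : Rp R) :
  series (fun m => kcoef m * ((\val x - r0) * (\val y - r0)) ^+ m) n @[n --> \oo] -->
  ki p alpha beta x y.
Proof.
suff -> : ki p alpha beta x y = expR (- (alpha ^+ 2 / beta)) *
    (p.[beta * ((\val x - r0) * (\val y - r0))] *
     expR (beta * ((\val x - r0) * (\val y - r0)))) by exact: cvg_kcoef_series.
have b0 : beta != 0 by rewrite gt_eqF.
have s0 : Num.sqrt beta != 0 by rewrite gt_eqF// sqrtr_gt0.
have sE : Num.sqrt beta ^+ 2 = beta by rewrite sqr_sqrtr// ltW.
rewrite mulrCA -expRD /ki; congr (horner p _ * expR _); last by field.
by move: s0 sE; move: (Num.sqrt beta) => s s0 <-; field; rewrite s0.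
Qed.

(** A product is bounded by the sum of the squares of its factors [a n] and
    [Num.sqrt (kcoef n) * r ^+ n]; the latter squares form the kernel series at [r ^+ 2]. *)
Lemma entire_l2 a : l2 a -> entire (fun m => a m * Num.sqrt (kcoef m)).
Proof.
move=> la r; apply: normed_cvg => /=.
apply: (@series_le_cvg _ _ ((fun m => a m ^+ 2) + (fun m => kcoef m * (r ^+ 2) ^+ m))) => //=.
- by move=> n; rewrite !fctE addr_ge0 ?sqr_ge0// mulr_ge0 ?kcoef_ge0// exprn_ge0 ?sqr_ge0.
- move=> n; rewrite !fctE -exprM mulnC exprM -mulrA normrM.
  have -> : kcoef n * (r ^+ n) ^+ 2 = `|Num.sqrt (kcoef n) * r ^+ n| ^+ 2.
    by rewrite real_normK ?num_real// exprMn sqr_sqrtr// kcoef_ge0.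
  rewrite -(real_normK (num_real (a n))).
  by move: `|a n| `|Num.sqrt _ * _| => u v; have := sqr_ge0 (u - v); nra.
- by apply: is_cvg_seriesD => //; apply/cvg_ex; eexists; exact: cvg_kcoef_series.
Qed.

(** The half-line contains points arbitrarily far to the right of the center, and convergence there
    extends inside the corresponding disc. *)
Lemma entire_halfline c : (forall x : Rp R, cvgn (pseries c (\val x - r0))) -> entire c.
Proof.
move=> cx r; have := cx (toRp (r0 + (`|r| + 1))).
rewrite val_toRp; last by rewrite !addr_ge0// divr_ge0// ltW.
rewrite addrC addKr => cr; apply: is_cvg_pseries_inside cr _.
by rewrite [ltRHS]ger0_norm ?addr_ge0// ltrDl.
Qed.

Definition psum_at c : Rp R -> R := (fun r => psum c (r - r0)) \o \val.

Lemma dcenter_psum_at c m : entire c -> d (psum_at c) m = m`!%:R * c m.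
Proof. by move=> cE; exact: (@dcenter_psum _ c). Qed.

(** The two weights differ by the factor [beta ^+ m / m!], a single term of the series of
    [expR beta]. *)
Lemma wcoef_le m (b : R) : wcoef p alpha beta m * `|b| ^+ 2 <=
  expR beta * (w m * `|m`!%:R * b| ^+ 2).
Proof.
have w0 := wcoef_ge0 m.
have e : beta ^+ m / m`!%:R <= expR beta.
  apply: (@le_trans _ _ (series (exp_coeff beta) m.+1)).
    rewrite /series /= big_nat_recr//= lerDr.
    by apply: sumr_ge0 => i _; apply: exp_coeff_ge0; exact: ltW.
  apply: series_le_lim; last exact: is_cvg_series_exp_coeff.
  by move=> i; apply: exp_coeff_ge0; exact: ltW.
have b0 : 0 < beta ^+ m by rewrite exprn_gt0.
rewrite normrM normr_nat /Hweight.
have -> : wcoef p alpha beta m * `|b| ^+ 2 = (beta ^+ m / m`!%:R) *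
    (wcoef p alpha beta m / (beta ^+ m * m`!%:R) * (m`!%:R * `|b|) ^+ 2).
  by field; rewrite (gt_eqF b0) (gt_eqF (fact0 m)).
by apply: ler_wpM2r => //; rewrite mulr_ge0 ?sqr_ge0// divr_ge0// mulr_ge0// ltW.
Qed.

Lemma Hki_psum_at c : entire c -> (forall m, h m = 0 -> c m = 0) ->
  cvgn (series (fun m => w m * (m`!%:R * c m) ^+ 2)) -> Hki_set p alpha beta (psum_at c).
Proof.
move=> cE c0 cw.
have dE m : d (psum_at c) m = m`!%:R * c m by exact: dcenter_psum_at.
have bE m : d (psum_at c) m / m`!%:R = c m.
  by rewrite dE mulrAC divff ?mul1r// gt_eqF.
have w0 := wcoef_ge0.
have cw' : cvgn (series (fun m => w m * `|d (psum_at c) m| ^+ 2)).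
  by under eq_fun do rewrite dE real_normK ?num_real//.
rewrite /Hki_set /=; split.
- move=> x; rewrite (_ : (fun m => _) = (fun m => c m * (\val x - r0) ^+ m)); first exact: cE.
  apply/funext => m; rewrite bE; case: ltP => hm; first by rewrite mul1r.
  by rewrite (c0 _ (hcoef_eq0 hm)) mulr0.
- apply/nneseries_lty => [m|]; first by rewrite mulr_ge0 ?sqr_ge0.
  apply: (@series_le_cvg _ _ (expR beta *: (fun m => w m * `|d (psum_at c) m| ^+ 2))).
  + by move=> m; rewrite mulr_ge0 ?sqr_ge0.
  + by move=> m; rewrite mulr_ge0 ?expR_ge0// mulr_ge0 ?sqr_ge0 ?Hweight_ge0.
  + by move=> m; rewrite bE fctE dE; exact: wcoef_le.
  + exact: is_cvg_seriesZ.
- by apply/nneseries_lty => // m; rewrite mulr_ge0 ?Hweight_ge0 ?sqr_ge0.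
Qed.

(** With [Hki_psum_at], this trades [Hki_set] for conditions on Taylor coefficients, on which the
    rest of the section works. *)
Lemma Hki_coefP f : Hki_set p alpha beta f ->
  exists c, [/\ entire c, f = psum_at c, forall m, h m = 0 -> c m = 0 &
    cvgn (series (fun m => w m * (m`!%:R * c m) ^+ 2))].
Proof.
move=> [fE _ fw]; pose c m := (0 < h m)%R%:R * (d f m / m`!%:R).
have cE : entire c by apply: entire_halfline => x; apply/cvg_ex; exists (f x); exact: fE.
have fc : f = psum_at c by apply/funext => x; apply/esym/cvg_lim => //; exact: fE.
exists c; split => //; first by move=> m hm; rewrite /c hm ltxx mul0r.
have w0 m : 0 <= w m * `|d f m| ^+ 2 by rewrite mulr_ge0 ?Hweight_ge0 ?sqr_ge0.
have dE m : m`!%:R * c m = d f m by rewrite fc dcenter_psum_at.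
under eq_fun do rewrite dE -real_normK ?num_real//.
exact/(nneseries_lty w0).
Qed.

Lemma psum_atP (x : R) c c' : entire c -> entire c' ->
  entire (x *: c + c') /\ psum_at (x *: c + c') = x *: psum_at c + psum_at c'.
Proof.
move=> cE cE'.
have E r : (fun m => (x *: c + c') m * r ^+ m) =
    x *: (fun m => c m * r ^+ m) + (fun m => c' m * r ^+ m).
  by apply/funext => m; rewrite !fctE /GRing.scale /=; ring.
split=> [r|].
  rewrite /pseries /= E; apply: is_cvg_seriesD; last exact: cE'.
  apply: is_cvg_seriesZ; exact: cE.
apply/funext => y; rewrite !fctE /psum_at /psum /= /pseries /= E.
rewrite (lim_seriesD (@is_cvg_seriesZ _ _ x (cE _)) (cE' _)).
by rewrite (lim_seriesZ x (cE _)).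
Qed.

Definition Hki_l2 f : nat -> R := fun m => Num.sqrt (w m) * d f m.

Lemma Hki_l2_sq f m : Hki_l2 f m ^+ 2 = w m * d f m ^+ 2.
Proof. by rewrite exprMn sqr_sqrtr// Hweight_ge0. Qed.

Lemma Hki_hilbert : is_hilbert (Hki p alpha beta).
Proof.
have P (x : R) f g : Hki_set p alpha beta f -> Hki_set p alpha beta g ->
    Hki_set p alpha beta (x *: f + g) /\ Hki_l2 (x *: f + g) = x *: Hki_l2 f + Hki_l2 g.
  move=> /Hki_coefP[c [cE -> c0 cw]] /Hki_coefP[c' [cE' -> c0' cw']].
  have [E <-] := psum_atP x cE cE'.
  have lE : Hki_l2 (psum_at (x *: c + c')) = x *: Hki_l2 (psum_at c) + Hki_l2 (psum_at c').
    apply/funext => m; rewrite /Hki_l2 !fctE !dcenter_psum_at//.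
    by rewrite /GRing.scale /=; ring.
  split => //; apply: Hki_psum_at => // [m hm|]; first by rewrite !fctE c0 ?c0'// scaler0 addr0.
  have -> : (fun m => w m * (m`!%:R * (x *: c + c') m) ^+ 2) =
      (fun m => (x *: Hki_l2 (psum_at c) + Hki_l2 (psum_at c')) m ^+ 2).
    by rewrite -lE; apply/funext => m; rewrite Hki_l2_sq dcenter_psum_at.
  apply: l2P.
  - by rewrite /=; under eq_fun do rewrite Hki_l2_sq dcenter_psum_at//.
  - by rewrite /=; under eq_fun do rewrite Hki_l2_sq dcenter_psum_at//.
have HL f : Hki_set p alpha beta f -> l2 (Hki_l2 f).
  move=> /Hki_coefP[c [cE -> c0 cw]].
  by rewrite /=; under eq_fun do rewrite Hki_l2_sq dcenter_psum_at//.
have w_gt0 m : 0 < h m -> 0 < w m.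
  by move=> hm; rewrite /Hweight /wcoef hm divr_gt0 ?invr_gt0// mulr_gt0// exprn_gt0.
apply: (@hilbert_transfer _ _ _ l2 _ Hki_l2) => //=.
- exact: l2_hilbert.
- have e0 : entire (0 : nat -> R).
    by move=> r; apply/cvgP/cvg_series0 => m; exact: mul0r.
  have -> : (0 : Rp R -> R) = psum_at 0.
    apply/funext => x; apply/esym/cvg_lim => //.
    by apply: cvg_series0 => m; exact: mul0r.
  apply: Hki_psum_at => //; apply/cvgP/cvg_series0 => m.
  by rewrite mulr0 expr0n mulr0.
- by move=> x f g Hf Hg; case: (P x f g Hf Hg).
- by move=> x f g Hf Hg; case: (P x f g Hf Hg).
- move=> f g _ _; rewrite /Hki_dot; congr (limn (series _)); apply/funext => m.
  by rewrite /Hki_l2 -{1}(sqr_sqrtr (Hweight_ge0 m)); ring.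
- move=> f /Hki_coefP[c [cE -> c0 _]] A0.
  apply/funext => x; apply/cvg_lim => //; apply: cvg_series0 => m /=.
  have [hm|hm] := ltP 0 (h m); last by rewrite (c0 _ (hcoef_eq0 hm)) mul0r.
  have := congr1 (fun a => a m) A0; rewrite /Hki_l2 dcenter_psum_at// => /eqP.
  rewrite !mulf_eq0 sqrtr_eq0 leNgt w_gt0//= (gt_eqF (fact0 m))/=.
  by move=> /eqP ->; rewrite mul0r.
- move=> u g Hu lg ug; pose c m := g m * Num.sqrt (kcoef m).
  (* Coordinates off the support of [h] are zero along the sequence, hence in its limit. *)
  have g0 m : h m = 0 -> g m = 0.
    move=> hm; apply/eqP; rewrite -normr_le0; apply: (cvgr_to_ge ug).
    apply: nearW => n.
    have lng : l2 (Hki_l2 (u n) - g) by exact: (hilbertB l2_hilbert (HL _ (Hu n)) lg).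
    rewrite -(@ler_pXn2r _ 2) ?nnegrE ?fs_norm_ge0// (fs_normsq l2_hilbert)//.
    apply: le_trans (l2_normsq_ge m lng); rewrite real_normK ?num_real//.
    by rewrite !fctE /Hki_l2 Hweight_eq0// sqrtr0 mul0r sub0r sqrrN.
  have cE : entire c by exact: entire_l2.
  have lE m : w m * (m`!%:R * c m) ^+ 2 = g m ^+ 2.
    transitivity (w m * m`!%:R ^+ 2 * kcoef m * g m ^+ 2).
      by rewrite -{1}(sqr_sqrtr (kcoef_ge0 m)) /c; ring.
    rewrite Hweight_kcoef; have [hm|hm] := ltP 0 (h m); first by rewrite mul1r.
    by rewrite (g0 _ (hcoef_eq0 hm)) expr0n mulr0.
  (* On the support of [h], [Num.sqrt (kcoef m)] is the inverse of [Num.sqrt (w m) * m!], so the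
     coefficients [c] are sent back to [g]. *)
  exists (psum_at c).
    apply: Hki_psum_at => // [m hm|]; first by rewrite /c g0// mul0r.
    by under eq_fun do rewrite lE.
  apply/funext => m; rewrite /Hki_l2 dcenter_psum_at// /c.
  have [hm|hm] := ltP 0 (h m); last by rewrite (g0 _ (hcoef_eq0 hm)) mul0r !mulr0.
  have := Hweight_kcoef m; rewrite hm => /(congr1 Num.sqrt); rewrite sqrtr1.
  have wf0 : 0 <= w m * m`!%:R ^+ 2 by rewrite mulr_ge0 ?Hweight_ge0 ?sqr_ge0.
  rewrite (sqrtrM _ wf0) (sqrtrM _ (Hweight_ge0 m)) sqrtr_sqr normr_nat => E.
  by rewrite -[RHS]mul1r -[X in _ = X * _]E; ring.
Qed.

Lemma Hki_rkhs : is_rkhs_of (ki p alpha beta) (Hki p alpha beta).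
Proof.
have kc x : exists2 c, c = (fun m => kcoef m * (\val x - r0) ^+ m) &
    [/\ entire c, ki p alpha beta x = psum_at c & Hki p alpha beta (ki p alpha beta x)].
  exists (fun m => kcoef m * (\val x - r0) ^+ m) => //.
  set c := (fun m => _).
  have cE : entire c.
    move=> r; apply/cvg_ex; eexists.
    rewrite /pseries /c /=; under eq_fun do rewrite -mulrA -exprMn.
    exact: cvg_kcoef_series.
  have kE : ki p alpha beta x = psum_at c.
    apply/funext => y; apply/esym/cvg_lim => //.
    rewrite /pseries /c /=; under eq_fun do rewrite -mulrA -exprMn.
    exact: cvg_ki_series.
  split => //; rewrite kE; apply: Hki_psum_at => // [m hm|].
    by rewrite /c /kcoef hm !mul0r.
  (* The squared norm of the section at [x] is the kernel series on the diagonal, hence finite. *)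
  have -> : (fun m => w m * (m`!%:R * c m) ^+ 2) =
      (fun m => kcoef m * ((\val x - r0) * (\val x - r0)) ^+ m).
    apply/funext => m; transitivity (w m * m`!%:R ^+ 2 * kcoef m *
      (kcoef m * ((\val x - r0) * (\val x - r0)) ^+ m)).
      by rewrite /c [in RHS]exprMn; ring.
    rewrite Hweight_kcoef; case: ltP => hm; first by rewrite mul1r.
    by rewrite /kcoef (hcoef_eq0 hm) !mul0r.
  by apply/cvg_ex; eexists; exact: cvg_ki_series.
have Hk x : Hki p alpha beta (ki p alpha beta x) by have [c _ []] := kc x.
have kE f x : Hki p alpha beta f -> f x = fs_dot (Hki p alpha beta) f (ki p alpha beta x).
  move=> /Hki_coefP[b [bE -> b0 _]]; have [c cdef [cE -> _]] := kc x.
  rewrite /= /Hki_dot /psum_at /= /psum; congr (limn (series _)); apply/funext => m /=.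
  rewrite !dcenter_psum_at// cdef.
  (* The weight cancels [kcoef m], leaving the Taylor series of [f] at [x]. *)
  transitivity (w m * m`!%:R ^+ 2 * kcoef m * (b m * (\val x - r0) ^+ m)); last by ring.
  rewrite Hweight_kcoef; case: ltP => hm; first by rewrite mul1r.
  by rewrite (b0 _ (hcoef_eq0 hm)) mul0r mulr0.
split => //; last by move=> f Hf x; exact: kE.
split; first exact: Hki_hilbert.
move=> x; exists (fs_norm (Hki p alpha beta) (ki p alpha beta x)) => f Hf.
by rewrite kE// mulrC; apply: (dot_CS Hki_hilbert).
Qed.

End Hki_rkhs.

(** * Exponential polynomials *)

Section exponential_polynomials.
Context {R : realType} {I : finType} (gamma : I -> R) (n : nat).
Implicit Types P : I -> {poly R}.

Definition expoly P (x : R) : R := \sum_(t : I) (P t).[x] * expR (gamma t * x).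

Definition expoly_deriv P t : {poly R} := (P t)^`() + gamma t *: P t.

Lemma is_derive_expoly P (x : R) :
  is_derive x 1 (expoly P) (expoly (expoly_deriv P) x).
Proof.
have term t : is_derive x 1 (fun r => (P t).[r] * expR (gamma t * r))
    ((expoly_deriv P t).[x] * expR (gamma t * x)).
  have dg : is_derive x 1 (fun r => gamma t * r) (gamma t).
    have := is_deriveZ (gamma t) (is_derive_id x (1 : R)).
    by rewrite /GRing.scale /= mulr1.
  have E := is_deriveM (is_derive_poly (P t) x)
    (@is_derive1_comp _ _ _ x _ _ (is_derive_expR (gamma t * x)) dg).
  apply: (is_derive_eq E); rewrite /expoly_deriv !hornerE /GRing.scale /=; ring.
rewrite /expoly; elim: (index_enum I) => [|t s IH].
  rewrite big_nil; under eq_fun do rewrite big_nil; exact: is_derive_cst.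
rewrite big_cons; under eq_fun do rewrite big_cons; exact: is_deriveD.
Qed.

(** A common degree bound gives finite dimension and survives differentiation, which sends each
    [P t] to its derivative plus [gamma t *: P t]. The frequencies may repeat. *)
Definition expoly_space : set (Rp R -> R) := [set f | exists2 P : I -> {poly R},
  (forall t, (size (P t) <= n.+1)%N) & f = expoly P \o \val].

Lemma expoly_space_deriv f : expoly_space f -> expoly_space (deriv_Rp f).
Proof.
move=> [P sP ->]; exists (expoly_deriv P) => [t|].
  apply: leq_trans (size_polyD _ _) _; rewrite geq_max.
  rewrite (leq_trans (size_scale_leq _ _))// andbT.
  exact: leq_trans (size_poly _ _) (leq_trans (leq_pred _) (sP t)).
by apply: deriv_Rp_val => x; exact: is_derive_expoly.
Qed.

Lemma expoly_space_C1 : expoly_space `<=` C1_Rp.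
Proof.
move=> f Vf; split.
  move=> x; have [P _ ->] := Vf; apply: derivable_Rp_val => r.
  exact: is_derive_expoly.
have [P _ ->] := expoly_space_deriv Vf => x.
apply: continuous_comp; first exact: val_Rp_continuous.
apply: differentiable_continuous; apply/derivable1_diffP.
by have [] := is_derive_expoly P (\val x).
Qed.

Lemma expoly_space_fin_dim : fin_dim_subspace expoly_space.
Proof.
pose J : finType := (I * 'I_n.+1)%type.
pose b (tm : J) : Rp R -> R := fun x => \val x ^+ tm.2 * expR (gamma tm.1 * \val x).
have bE (c : J -> R) : \sum_(i < #|J|) c (enum_val i) *: b (enum_val i) =
    expoly (fun t => \poly_(m < n.+1) c (t, inord m)) \o \val.
  have -> : \sum_(i < #|J|) c (enum_val i) *: b (enum_val i) = \sum_tm c tm *: b tm.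
    by rewrite [RHS](reindex _ (onW_bij _ (@enum_val_bij J))).
  apply/funext => x; rewrite fct_sumE /expoly /=.
  under [RHS]eq_bigr do rewrite horner_poly mulr_suml.
  rewrite pair_bigA; apply: eq_bigr => -[t m] _.
  by rewrite /= inord_val -mulrA.
exists #|J|, (fun i => b (enum_val i)).
apply/seteqP; split => f /= [].
  move=> P sP ->; pose c (tm : J) := (P tm.1)`_tm.2.
  exists (fun i => c (enum_val i)); rewrite bE; congr (expoly _ \o _); apply/funext => t.
  apply/polyP => m; rewrite coef_poly; case: ltnP => mn /=; first by rewrite /c /= inordK.
  by rewrite nth_default// (leq_trans (sP t)).
move=> c ->; exists (fun t => \poly_(m < n.+1) c (enum_rank (t, inord m))).
  by move=> t; exact: size_poly.
by rewrite -(bE (fun tm => c (enum_rank tm))); apply: eq_bigr => i _; rewrite enum_valK.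
Qed.

End exponential_polynomials.

(** With [y] fixed the argument of [p] is affine in [x], so composition does not raise the degree;
    the part of the exponential free of [x] becomes a scalar. *)
Lemma ki_expoly_term {R : realType} (p : {poly R}) (alpha beta : R) (y : Rp R) :
  exists2 q : {poly R}, (size q <= size p)%N &
    forall x, ki p alpha beta y x = q.[\val x] * expR ((beta * \val y - alpha) * \val x).
Proof.
pose s := Num.sqrt beta; pose u := s * \val y - alpha / s.
pose l : {poly R} := (u * s) *: 'X - (u * (alpha / s))%:P.
exists (expR (- (alpha * \val y)) *: (p \Po l)) => [|x].
  apply: leq_trans (size_scale_leq _ _) _.
  have sl : (size l <= 2)%N.
    apply: leq_trans (size_polyD _ _) _; rewrite geq_max size_polyN.
    rewrite (leq_trans (size_scale_leq _ _)) ?size_polyX//.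
    by rewrite (leq_trans (size_polyC_leq1 _)).
  (* The bound in [size_comp_poly_leq] is at least 1, too large when [p = 0]. *)
  have [->|p0] := eqVneq p 0; first by rewrite comp_poly0 size_poly0.
  apply: leq_trans (size_comp_poly_leq _ _) _.
  rewrite -[leqRHS]prednK ?size_poly_gt0// ltnS -[leqRHS]muln1 leq_mul2l.
  by apply/orP; right; case: (size l) sl => [|[|[]]].
rewrite /ki hornerZ horner_comp /l hornerD hornerN hornerZ hornerX hornerC -/s -/u.
rewrite [RHS]mulrAC -expRD [RHS]mulrC; congr (horner p _ * expR _); ring.
Qed.

Theorem proposition3p10 (R : realType) (d : nat)
    (a : nat -> 'I_d.+1 -> R) (alpha beta : 'I_d.+1 -> R)
    (a_ge0 : forall l i, (l <= d)%N -> 0 <= a l i)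
    (alpha_ge0 : forall i, 0 <= alpha i)
    (beta_gt0 : forall i, 0 < beta i) :
  let p := fun i : 'I_d.+1 => \poly_(l < d.+1) a l i in
  let k := fun x y : Rp R => \sum_(i < d.+1) ki (p i) (alpha i) (beta i) x y in
  let H := fun i : 'I_d.+1 => Hki (p i) (alpha i) (beta i) in
  [/\ is_kernel k,
      fully_consistent k,
      forall i, is_rkhs_of (ki (p i) (alpha i) (beta i)) (H i),
      exists Hk : fun_space, is_rkhs_of k Hk &
      forall Hk : fun_space, is_rkhs_of k Hk ->
        fs_set Hk = sum_set H /\
        forall f, Hk f -> is_min (sum_normsq_set H f) (fs_norm Hk f ^+ 2)].
Proof.
move=> p k H.
have rH i : is_rkhs_of (ki (p i) (alpha i) (beta i)) (H i).
  apply: Hki_rkhs => // l; rewrite coef_poly; case: ifP => // ld.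
  exact: a_ge0.
have rk : is_rkhs_of k (rkhs_sum H) := rkhs_sumP rH.
split => //; [exact: rkhs_kernel rk| |by exists (rkhs_sum H)|].
  move=> N y; pose I : finType := ('I_d.+1 * 'I_N)%type.
  (* One frequency per summand and per chosen point, so that a single space serves every [y j]. *)
  pose gamma (t : I) := beta t.1 * \val (y t.2) - alpha t.1.
  exists (expoly_space gamma d); split.
  - exact: expoly_space_fin_dim.
  - exact: expoly_space_C1.
  - exact: expoly_space_deriv.
  - move=> j.
    have /choice[q qP] : forall i, exists q : {poly R}, (size q <= d.+1)%N /\
        forall x, ki (p i) (alpha i) (beta i) (y j) x = q.[\val x] * expR (gamma (i, j) * \val x).
      move=> i; have [q sq qE] := ki_expoly_term (p i) (alpha i) (beta i) (y j).
      by exists q; split => //; apply: leq_trans sq (size_poly _ _).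
    (* Only the frequencies belonging to the point [y j] enter its section. *)
    exists (fun t => if t.2 == j then q t.1 else 0).
      by move=> t; case: ifP => _; [case: (qP t.1)|rewrite size_poly0].
    apply/funext => x; rewrite /expoly /=.
    rewrite -(pair_bigA _ (fun i j' => (if j' == j then q i else 0).[\val x] *
      expR (gamma (i, j') * \val x))) /=.
    apply: eq_bigr => i _; rewrite (bigD1 j)//= eqxx big1 ?addr0.
      by case: (qP i) => _ ->.
    by move=> j' /negbTE ->; rewrite horner0 mul0r.
exact: (rkhs_sum_unique rH).
Qed.
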